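(* Let $\mathbf{k}$ be an algebraically closed field of characteristic $p>0$. Let $Q=(q_0,\dots,q_n)$ be a well-formed weight, and let $(X,\Delta)$ be the non-klt Campana toric orbifold over $\mathbf{k}$ such that $X$ is the weighted projective space $\mathbb{P}(q_0,\dots,q_n)$ and every component of its toric boundary divisor $\Delta$ has coefficient one. If $p$ divides one of the weights $q_j$, then $(X,\Delta)$ is not separably Campana rationally connected.
   Context: Weighted projective spaces. A tuple of positive integers $(q_0,\dots,q_n)$ is a well-formed weight if $n\geq 1$ and any $n$ elements among the $q_i$ are coprime (have greatest common divisor $1$). Let $v_0,\dots,v_n\in\mathbb{Z}^n$ be the primitive generators of the rays of the fan of $\mathbb{P}^n$ (so $\sum_i v_i=0$ and $v_0,\dots,v_{n-1}$ is a basis of $\mathbb{Z}^n$), put $e_i=\frac{1}{q_i}v_i$, and let $N$ be the lattice generated by $e_0,\dots,e_n$. $\mathbb{P}(q_0,\dots,q_n)$ is the toric variety of the fan $\Sigma$ in $N_{\mathbb{R}}$ whose cones are generated by all proper subsets of $\{e_0,\dots,e_n\}$. Toric setting. Let $X$ be a projective toric variety over $\mathbf{k}$ with character lattice $M$, dual lattice $N$, fan $\Sigma$, rays $\rho_i$ with primitive generators $u_i\in N$, corresponding torus-invariant prime divisors $\Delta_i$, and toric boundary $\Delta=\sum_i\Delta_i$. $X$ is endowed with the divisorial log structure induced by $\Delta$ (the sheaf of regular functions invertible on $X\setminus\Delta$). A Campana toric orbifold $(X,\Delta_\epsilon)$ is obtained by assigning to each $\Delta_i$ some $m_i\in\mathbb{Z}_{\geq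 1}\cup\{\infty\}$ and setting $\epsilon_i=1-\frac{1}{m_i}$, $\Delta_\epsilon=\sum_i\epsilon_i\Delta_i$; it is non-klt if some $\epsilon_i=1$. Here all coefficients are one, i.e. $m_i=\infty$ for all $i$ and $\Delta_\epsilon=\Delta$ (''absolute non-klt''). Log maps and contact orders. A genus zero non-degenerate stable log map to $X$ is a morphism $f:\mathbb{P}^1\to X$ with distinct marked points $p_1,\dots,p_r\in\mathbb{P}^1$, stable in the usual sense as a pointed map, with $f(\mathbb{P}^1)\not\subset\Delta$ and $f^{-1}(\Delta)\subset\{p_1,\dots,p_r\}$ (it is a log morphism when $\mathbb{P}^1$ carries the divisorial log structure of the marked points). Its contact order at $p_k$ is the element $c_k\in N$ such that for all $m\in M$ the rational function $f^*\chi^m$ has order $\langle m,c_k\rangle$ at $p_k$; if $f(p_k)$ lies in the torus orbit of the cone $\tau\in\Sigma$, then $c_k\in N\cap\tau$. Write $c_k=\sum_i c_{k,i}u_i$ with $c_{k,i}\geq 0$ and only rays of the smallest cone containing $c_k$ occurring; $c_{k,i}$ is the multiplicity of $\Delta_i$ at the $k$-th marked point. A collection of contact orders $\varsigma=\{c_k\}$ is of Campana type if: (1) whenever $m_i<\infty$, every $k$ satisfies $c_{k,i}=0$ or $c_{k,i}\geq m_i$; (2) whenever $m_i=\infty$, there is at most one index $k$ with $c_{k,i}>0$. Separable Campana rational connectedness. $X$ is separably rationally $\varsigma$-connected if there is a family of genus zero non-degenerate stable log maps with contact orders $\varsigma$, $\pi:\mathcal{U}\to W$, $ev:\mathcal{U}\to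 X$, over a variety $W$, with underlying scheme of $\mathcal{U}$ equal to $W\times\mathbb{P}^1$ (with disjoint sections as markings), such that $ev^{(2)}:\mathcal{U}\times_W\mathcal{U}=W\times\mathbb{P}^1\times\mathbb{P}^1\to X\times X$ is dominant and separable. $(X,\Delta_\epsilon)$ is separably Campana rationally connected if there exists a collection $\varsigma$ of Campana type such that $X$ is separably rationally $\varsigma$-connected. *)

(* Defs.v *)
From HB Require Import structures.
From mathcomp Require Import all_boot all_order all_algebra all_field.
From mathcomp Require Import all_classical topology.
From mathcomp Require Import -(notations) mpoly.

Set Implicit Arguments.
Unset Strict Implicit.
Unset Printing Implicit Defensive.

Import Order.TTheory GRing.Theory Num.Theory.
Local Open Scope classical_set_scope.
Local Open Scope ring_scope.

(******************************************************************************)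
(* Varieties over an algebraically closed field k are classical varieties:    *)
(* spaces with functions, i.e. topological spaces (of closed points) with a   *)
(* sheaf of k-valued functions, which are irreducible, separated and covered  *)
(* by finitely many affine opens.                                             *)
(******************************************************************************)

(* [regular_at x phi]: the germ at x of the total function phi is the germ of
   a section of the structure sheaf; values of phi away from x are junk. *)
Record kspace (k : fieldType) := KSpace {
  kpt :> topologicalType;
  regular_at : kpt -> (kpt -> k) -> Prop;
  regular_germ : forall x phi psi,
    (\forall y \near x, phi y = psi y) -> regular_at x phi -> regular_at x psi
}.

(* Gluing: an atlas on a set T is a family of pairs (U, A), a chart U together
   with its coordinate ring A, the values on U of the members of A.  Basic opens
   are U `&` [g != 0]; regular functions are locally fractions f / g. *)
Section Gluing.
Variables (k : fieldType) (T : Type) (atlas : set (set T * set (T -> k))).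

Definition glued : Type := let _ := atlas in T.

Definition basic_opens : set (set T) :=
  [set B | exists C, exists2 g, atlas C /\ C.2 g & B = C.1 `&` [set x | g x != 0]].

HB.instance Definition _ := gen_eqMixin glued.
HB.instance Definition _ := gen_choiceMixin glued.
HB.instance Definition _ :=
  @isSubBaseTopological.Build glued (set glued) basic_opens id.

Definition glued_regular (x : glued) (phi : glued -> k) : Prop :=
  exists C f g, [/\ atlas C, C.2 f, C.2 g, C.1 x /\ g x != 0 &
    \forall y \near x, phi y = f y / g y].

Lemma glued_germ (x : glued) (phi psi : glued -> k) :
  (\forall y \near x, phi y = psi y) ->
  glued_regular x phi -> glued_regular x psi.
Proof.
move=> e [C [f [g [aC Cf Cg Cx h]]]]; exists C, f, g; split=> //.
by near=> y; rewrite -(near e y)//; near: y.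
Unshelve. all: by end_near.
Qed.

Definition glued_space : kspace k := KSpace glued_germ.
End Gluing.

Section SubSpace.
Variables (k : fieldType) (X : kspace k) (Z : set X).

Definition sub_regular (z : set_type Z) (phi : set_type Z -> k) : Prop :=
  exists2 psi, regular_at (\val z) psi & \forall y \near z, phi y = psi (\val y).

Lemma sub_germ (z : set_type Z) (phi psi : set_type Z -> k) :
  (\forall y \near z, phi y = psi y) -> sub_regular z phi -> sub_regular z psi.
Proof.
move=> e [chi rchi h]; exists chi => //.
by near=> y; rewrite -(near e y)//; near: y.
Unshelve. all: by end_near.
Qed.

Definition subspace : kspace k := KSpace sub_germ.
End SubSpace.

Section Varieties.
Variable k : fieldType.
Implicit Types X Y : kspace k.

Definition regular_on X (U : set X) (phi : X -> k) : Prop :=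
  forall x, U x -> regular_at x phi.

Definition kmorphism X Y (f : X -> Y) : Prop :=
  continuous f /\ forall x phi, regular_at (f x) phi -> regular_at x (phi \o f).

Definition kisomorphic X Y : Prop :=
  exists (f : X -> Y) (g : Y -> X),
    [/\ kmorphism f, kmorphism g, cancel f g & cancel g f].

Definition affine_space (m : nat) : kspace k :=
  glued_space [set ([set: 'I_m -> k],
    [set f | exists P : mpoly m k, f = fun x => meval x P])].

Definition zero_locus m (S : set (mpoly m k)) : set (affine_space m) :=
  [set x | forall P, S P -> meval x P = 0].

Definition is_affine X : Prop :=
  exists m (S : set (mpoly m k)), kisomorphic X (subspace (zero_locus S)).

(* U x V carries the coordinate ring O(U) (x) O(V); as in any category of
   varieties, the topology is finer than the product topology. *)
Definition prod_space X Y : kspace k :=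
  glued_space [set C : set (X * Y) * set (X * Y -> k) |
    exists (U : set X) (V : set Y), [/\ open U, open V, C.1 = U `*` V &
      C.2 = [set h | exists l (a : 'I_l -> X -> k) (b : 'I_l -> Y -> k),
        (forall i, regular_on U (a i) /\ regular_on V (b i)) /\
        h = fun z => \sum_(i < l) a i z.1 * b i z.2]]].

Definition irreducible_space X : Prop :=
  [set: X] !=set0 /\ forall U : set X, open U -> U !=set0 -> dense U.

Definition separated_space X : Prop :=
  closed [set z : prod_space X X | z.1 = z.2].

Definition is_variety X : Prop :=
  [/\ irreducible_space X, separated_space X &
      exists l (U : 'I_l -> set X),
        (forall i, open (U i) /\ is_affine (subspace (U i))) /\
        \bigcup_i U i = setT].

(* k u {oo}, glued from two copies of the affine line along z -> 1/z. *)
Definition proj_line : kspace k :=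
  let z (x : option k) := if x is Some a then a else 0 in
  let w (x : option k) := if x is Some a then a^-1 else 0 in
  @glued_space k (option k)
    [set ([set x | x != None], [set f | exists P : {poly k}, f = fun x => P.[z x]]);
         ([set x | x != Some 0], [set f | exists P : {poly k}, f = fun x => P.[w x]])].

(* t generates the maximal ideal of the local ring at x. *)
Definition uniformizer X (x : X) (t : X -> k) : Prop :=
  [/\ regular_at x t, t x = 0 &
      forall phi, regular_at x phi -> phi x = 0 ->
        exists2 psi, regular_at x psi & \forall y \near x, phi y = t y * psi y].

(* Order of a rational function on a curve; the values of g at x itself and
   outside a neighbourhood of x are irrelevant. *)
Definition has_order X (x : X) (g : X -> k) (d : int) : Prop :=
  exists t u, [/\ uniformizer x t, regular_at x u, u x != 0 &
    \forall y \near x^', g y = u y * t y ^ d].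

(* Rational functions are represented by total functions that are regular on a
   dense open set, up to equality on a dense open set. *)
Definition rational_fun X (phi : X -> k) : Prop :=
  exists U : set X, [/\ open U, dense U & regular_on U phi].

Definition generically_equal X (phi psi : X -> k) : Prop :=
  exists U : set X, [/\ open U, dense U & forall x, U x -> phi x = psi x].

(* cls exhibits K as the function field of the irreducible space X; cls is only
   meaningful on functions satisfying rational_fun. *)
Record function_field X (K : fieldType) (cls : (X -> k) -> K) : Prop := {
  ff_one : cls (fun=> 1) = 1;
  ff_add : forall phi psi, rational_fun phi -> rational_fun psi ->
    cls (fun x => phi x + psi x) = cls phi + cls psi;
  ff_mul : forall phi psi, rational_fun phi -> rational_fun psi ->
    cls (fun x => phi x * psi x) = cls phi * cls psi;
  ff_surj : forall a, exists2 phi, rational_fun phi & cls phi = a;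
  ff_eq : forall phi psi, rational_fun phi -> rational_fun psi ->
    (cls phi = cls psi <-> generically_equal phi psi)
}.

End Varieties.

Section SeparableExtension.
Variables (L K : fieldType) (iota : {rmorphism L -> K}).

Definition alg_independent d (t : 'I_d -> K) : Prop :=
  forall P : mpoly d L, mmap iota t P = 0 -> P = 0.

Definition generated_field d (t : 'I_d -> K) : set K :=
  [set x | exists P Q : mpoly d L,
     mmap iota t Q != 0 /\ x = mmap iota t P / mmap iota t Q].

Definition separable_algebraic (F : set K) (x : K) : Prop :=
  exists P : {poly K}, [/\ forall i, F P`_i, separable_poly P & root P x].

(* K / L has a separating transcendence basis; for the finitely generated
   extensions considered here this is separability. *)
Definition separable_extension : Prop :=
  exists d (t : 'I_d -> K),
    alg_independent t /\ forall x, separable_algebraic (generated_field t) x.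
End SeparableExtension.

Definition dominant (k : fieldType) (Y Z : kspace k) (f : Y -> Z) : Prop :=
  dense (range f).

(* For a dominant morphism f of varieties: k(Y) / k(Z) is separable.  The
   function fields are unique up to isomorphism. *)
Definition separable_morphism (k : fieldType) (Y Z : kspace k) (f : Y -> Z) :=
  exists (K L : fieldType) (clsY : (Y -> k) -> K) (clsZ : (Z -> k) -> L)
         (iota : {rmorphism L -> K}),
    [/\ function_field clsY, function_field clsZ,
        forall phi, rational_fun phi -> iota (clsZ phi) = clsY (phi \o f) &
        separable_extension iota].

(* A fan in N_Q = Q^n: the lattice N, the primitive generators u_i of the rays,
   and the cones, each given by its set of rays.  (Everything is rational, so
   N_Q serves as well as N_R.) *)
Record fan (n r : nat) := Fan {
  lattice : set 'rV[rat]_n;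
  ray : 'I_r -> 'rV[rat]_n;
  cones : {set {set 'I_r}}
}.

Section Toric.
Variables (n r : nat) (S : fan n r).

Definition pairing (m v : 'rV[rat]_n) : rat := \sum_(i < n) m 0 i * v 0 i.

Definition characters : set 'rV[rat]_n :=
  [set m | forall v, lattice S v -> pairing m v \is a Num.int].

Definition in_cone (s : {set 'I_r}) (v : 'rV[rat]_n) : Prop :=
  exists a : 'I_r -> rat,
    (forall i, 0 <= a i) /\ v = \sum_(i in s) a i *: ray S i.

(* The semigroup of integral points of the dual cone. *)
Definition dual_semigroup (s : {set 'I_r}) : set 'rV[rat]_n :=
  [set m | characters m /\ forall v, in_cone s v -> 0 <= pairing m v].

Definition orthogonal (s : {set 'I_r}) : set 'rV[rat]_n :=
  [set m | forall v, in_cone s v -> pairing m v = 0].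

(* A closed point of the affine toric variety U_s = Spec k[dual_semigroup s] is
   a homomorphism from dual_semigroup s to the multiplicative monoid of k.  A
   point of the toric variety is recorded by its homomorphism on the smallest
   chart U_s containing it: smallest means that no character outside s^perp is invertible at the
   point, i.e. that the point lies in the orbit of s.  The homomorphism is
   extended by 0 to all of Q^n. *)
Record toric_point (k : fieldType) := ToricPoint {
  orbit_cone : {set 'I_r};
  chi : 'rV[rat]_n -> k;
  orbit_coneP : orbit_cone \in cones S;
  chi0 : chi 0 = 1;
  chiD : forall m m', dual_semigroup orbit_cone m ->
    dual_semigroup orbit_cone m' -> chi (m + m') = chi m * chi m';
  chi_minimal : forall m, dual_semigroup orbit_cone m ->
    ~ orthogonal orbit_cone m -> chi m = 0;
  chi_default : forall m, ~ dual_semigroup orbit_cone m -> chi m = 0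
}.

Definition character_fun (k : fieldType) (m : 'rV[rat]_n) (x : toric_point k) :=
  chi x m.

Definition toric_variety (k : fieldType) : kspace k :=
  glued_space [set C : set (toric_point k) * set (toric_point k -> k) |
    exists s, [/\ s \in cones S, C.1 = [set x | orbit_cone x \subset s] &
      C.2 = [set f | exists l (c : 'I_l -> k) (m : 'I_l -> 'rV[rat]_n),
        (forall i, dual_semigroup s (m i)) /\
        f = fun x => \sum_(i < l) c i * character_fun (m i) x]]].

(* The divisor of the ray i is the union of the orbits of the cones having i as
   a ray. *)
Definition toric_divisor (k : fieldType) (i : 'I_r) : set (toric_variety k) :=
  [set x : toric_point k | i \in orbit_cone x].

Definition toric_boundary (k : fieldType) : set (toric_variety k) :=
  \bigcup_i toric_divisor i.

(* a i is the multiplicity along the i-th boundary divisor of the contact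
   order c: the coefficients of c on the rays of the smallest cone s. *)
Definition contact_multiplicity (c : 'rV[rat]_n) (a : 'I_r -> rat) : Prop :=
  exists2 s, s \in cones S & [/\ in_cone s c,
    forall s', s' \in cones S -> in_cone s' c -> s \subset s',
    forall i, 0 <= a i, forall i, i \notin s -> a i = 0 &
    c = \sum_i a i *: ray S i].

End Toric.

(* None encodes m_i = oo. *)
Definition campana_orbifold r (m : 'I_r -> option nat) : Prop :=
  forall i, m i != Some 0%N.

Definition campana_coeff (m : option nat) : rat :=
  if m is Some d then 1 - d%:R^-1 else 1.

Definition campana_type n r (S : fan n r) (m : 'I_r -> option nat)
    l (c : 'I_l -> 'rV[rat]_n) : Prop :=
  exists a : 'I_l -> 'I_r -> rat,
    (forall j, contact_multiplicity S (c j) (a j)) /\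
    forall i, if m i is Some d then forall j, a j i = 0 \/ d%:R <= a j i
              else forall j j', 0 < a j i -> 0 < a j' i -> j = j'.

Section LogMaps.
Variables (k : fieldType) (n r : nat) (S : fan n r).
Let X := toric_variety S k.
Let P1 := proj_line k.

Definition stable_log_map l (f : P1 -> X) (p : 'I_l -> P1)
    (c : 'I_l -> 'rV[rat]_n) : Prop :=
  [/\ kmorphism f, injective p,
      (exists x y, f x <> f y) \/ (3 <= l)%N,
      (exists x, ~ toric_boundary (f x)) /\
      (forall x, toric_boundary (f x) -> exists j, x = p j) &
      forall j, lattice S (c j) /\
        forall m, characters S m -> exists2 d : int,
          pairing m (c j) = d%:~R & has_order (p j) (character_fun m \o f) d].

(* The sections mark j of W x P1 -> W are automatically disjoint, since the
   markings of each fibre are distinct. *)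
Definition log_map_family (W : kspace k) l (ev : prod_space W P1 -> X)
    (mark : 'I_l -> W -> prod_space W P1) (c : 'I_l -> 'rV[rat]_n) : Prop :=
  [/\ kmorphism ev,
      forall j, kmorphism (mark j) /\ forall w, (mark j w).1 = w &
      forall w, stable_log_map (fun x => ev (w, x)) (fun j => (mark j w).2) c].

Definition ev2 (W : kspace k) (ev : prod_space W P1 -> X)
    (z : prod_space (prod_space W P1) P1) : prod_space X X :=
  (ev (z.1.1, z.1.2), ev (z.1.1, z.2)).

Definition separably_rationally_connected_by l (c : 'I_l -> 'rV[rat]_n) : Prop :=
  exists (W : kspace k) (ev : prod_space W P1 -> X)
         (mark : 'I_l -> W -> prod_space W P1),
    [/\ is_variety W, log_map_family ev mark c, dominant (ev2 ev) &
        separable_morphism (ev2 ev)].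

Definition separably_campana_rationally_connected (m : 'I_r -> option nat) :=
  exists l (c : 'I_l -> 'rV[rat]_n),
    campana_type S m c /\ separably_rationally_connected_by c.

End LogMaps.

Definition well_formed n (q : 'I_n.+1 -> nat) : Prop :=
  [/\ (1 <= n)%N, forall i, (0 < q i)%N &
      forall j, \big[gcdn/0]_(i | i != j) q i = 1%N].

(* v_0, ..., v_(n-1) is the standard basis and v_n = - (v_0 + ... + v_(n-1)). *)
Definition pn_ray n (i : 'I_n.+1) : 'rV[rat]_n :=
  if unlift ord_max i is Some j then delta_mx 0 j else const_mx (- 1).

Definition weighted_ray n (q : 'I_n.+1 -> nat) (i : 'I_n.+1) : 'rV[rat]_n :=
  (q i)%:R^-1 *: pn_ray i.

(* The toric variety of this fan is P(q_0, ..., q_n). *)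
Definition weighted_fan n (q : 'I_n.+1 -> nat) : fan n n.+1 :=
  Fan (inIntSpan [tuple weighted_ray q i | i < n.+1]) (weighted_ray q)
      [set s : {set 'I_n.+1} | s != [set: 'I_n.+1]%SET]%SET.

Lemma weighted_ray_coord n (q : 'I_n.+1 -> nat) (b : 'I_n.+1 -> rat) (j : 'I_n) :
  (\sum_i b i *: weighted_ray q i) 0 j =
  b (lift ord_max j) / (q (lift ord_max j))%:R - b ord_max / (q ord_max)%:R.
Proof.
rewrite summxE (bigD1 ord_max)//= (bigD1 (lift ord_max j))/=; last first.
  by rewrite eq_sym neq_lift.
rewrite big1 => [|i /andP[im ij]]; last first.
  rewrite !mxE /weighted_ray /pn_ray; case: unliftP im ij => [j' ->|->]; last by rewrite eqxx.
  move=> _; rewrite (inj_eq (@lift_inj _ _)) => /negPf jj.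
  by rewrite !mxE eqxx /= eq_sym jj !mulr0.
rewrite !mxE /weighted_ray /pn_ray liftK unlift_none !mxE !eqxx addr0.
by rewrite mulr1 mulrN1 mulrN addrC.
Qed.

(* Hence the rays of weighted_fan q are indeed the primitive generators. *)
Lemma weighted_ray_primitive n (q : 'I_n.+1 -> nat) (i : 'I_n.+1) (a : rat) :
  well_formed q -> 0 < a ->
  lattice (weighted_fan q) (a *: weighted_ray q i) -> 1 <= a.
Proof.
move=> [_ q0 qg] a0 [b]; under eq_bigr do rewrite -tnth_nth tnth_mktuple -scaler_int.
move=> e.
pose c j := (b j)%:~R - (if j == i then a else 0) : rat.
have cE : \sum_j c j *: weighted_ray q j = 0.
  under eq_bigr do rewrite /c scalerBl.
  rewrite sumrB -e (bigD1 i)//= eqxx big1 ?addr0 ?subrr// => j /negPf ->.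
  by rewrite scale0r.
have qn0 j : (q j)%:R != 0 :> rat by rewrite pnatr_eq0 -lt0n.
pose s := c ord_max / (q ord_max)%:R.
have cs j : c j = s * (q j)%:R.
  have [j' ->|->] := unliftP ord_max j; last by rewrite divfK.
  move/matrixP: cE => /(_ 0 j'); rewrite weighted_ray_coord mxE => /eqP.
  by rewrite subr_eq0 /s => /eqP <-; rewrite divfK.
have /dvdn_biggcdP : forall j, j != i -> (`|denq s| %| q j)%N.
  move=> j /negPf ji; have := cs j; rewrite /c ji subr0 => /esym h.
  have : numq s * (q j)%:Z = denq s * b j.
    apply: (@intr_inj rat); rewrite !intrM -h -[in LHS]pmulrn.
    by rewrite numqE mulrAC mulrC -mulrA.
  move/(congr1 absz); rewrite !abszM /= => h2.
  rewrite -(@Gauss_dvdr _ `|numq s|%N) ?h2 ?dvdn_mulr//.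
  by rewrite coprime_sym coprime_num_den.
rewrite qg dvdn1 => /eqP d1.
have sZ : s \is a Num.int by rewrite Qint_def -absz_denq d1.
have ai : a \is a Num.int.
  have -> : a = (b i)%:~R - s * (q i)%:R by rewrite -cs /c eqxx opprB addrC subrK.
  by apply: rpredB (rpred_int _ _) (rpredM sZ (rpred_nat _ _)).
by move: ai a0 => /intrP[z ->]; rewrite ltr0z ler1z -gtz0_ge1.
Qed.

(* Main.v *)
From HB Require Import structures.
From mathcomp Require Import all_boot all_order all_algebra all_field.
From mathcomp Require Import finmap all_classical topology.
From mathcomp Require Import ring.
From mathcomp Require Import -(notations) mpoly.
Require Import Defs.

(* Every contact order is a positive combination of rays, no ray is shared by two
   markings, and the contact orders sum to zero; as sum_i q_i e_i = 0 is the only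
   relation between the rays, the total contact order along the i-th divisor is
   proportional to q_i.  When p divides some q_j, this yields a character m that
   is not a p-th power although all its contact orders <m, c_k> are divisible
   by p.  On a curve of the family the pullback of chi^m is a constant times
   prod_k (t - p_k)^<m, c_k>, so the pullback of chi^m(x) / chi^m(y) under ev^(2),
   from which the constant drops out, is a p-th power in k(W x P^1 x P^1).  By
   separability it is already a p-th power in k(X x X); restricting to an orbit
   of a one-parameter subgroup with p not dividing <m, u> gives a contradiction. *)

Set Implicit Arguments.
Unset Strict Implicit.
Unset Printing Implicit Defensive.

Import Order.TTheory GRing.Theory Num.Theory.
Local Open Scope classical_set_scope.
Local Open Scope ring_scope.

(** * p-th roots in separable extensions *)

(** A character is recorded by its integer values a_i on the rays, subject only to sum_i q_i a_i =
    0. The hypothesis on q_j is what allows a_j = 1 together with p | a_i for all i <> j: the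
    remaining weights are coprime, so the relation is solvable as soon as p divides q_j.
    Divisibility of the contact orders is then clear at each marking that meets a single divisor,
    except at the one on the j-th divisor, where the vanishing of the total decides. A marking
    meeting two divisors forces their contact orders to be proportional, and a different character,
    of order zero everywhere, is used.

    The constant in front of the product depends on the curve, that is on w, and need not be a p-th
    power in k(W); hence two points of the same curve are compared instead of pulling back along ev
    alone.

    Density of nonempty open sets in W x P^1 x P^1 and X x X is extracted from the function fields
    that come with separability. *)

(** Over K the polynomial X^p - beta becomes (X - b)^p, so its gcd with P is a power of X - b, and
    separability of P leaves exactly the first power. The gcd is already computed over F, hence so
    is its root b. *)
Lemma separable_pth_root (F K : fieldType) (v : {rmorphism F -> K}) (p : nat)
    (P : {poly F}) (beta : F) (b : K) :
  p \in [pchar K] -> separable_poly (map_poly v P) -> root (map_poly v P) b ->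
  v beta = b ^+ p -> exists b', b = v b'.
Proof.
move=> pK sepP Pb bE.
pose G' := gcdp P ('X^p - beta%:P).
have qE : map_poly v ('X^p - beta%:P) = ('X - b%:P) ^+ p.
  rewrite rmorphB /= map_polyXn map_polyC /= bE.
  have pP : p \in [pchar {poly K}] by rewrite pchar_poly.
  rewrite -!(pFrobenius_autE pP) pFrobenius_autB_comm ?pFrobenius_autE ?rmorphXn //.
  exact: mulrC.
pose G := map_poly v G'.
have GE : G = gcdp (map_poly v P) (('X - b%:P) ^+ p).
  by rewrite /G /G' gcdp_map qE.
have sepG : separable_poly G by rewrite GE (dvdp_separable (dvdp_gcdl _ _)).
have Gb : root G b.
  by rewrite GE root_gcd Pb -(prednK (prime_gt0 (pcharf_prime pK))) root_exp_XsubC /=.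
have /dvdp_exp_XsubCP [i ip iE] : G %| ('X - b%:P) ^+ p by rewrite GE dvdp_gcdr.
have i1 : i = 1%N.
  case: i iE {ip} => [|[//|i]] iE.
    by move: Gb; rewrite (eqp_root iE) expr0 (negPf (root1 _)).
  have/separable_polyP[/(_ ('X - b%:P) ('X - b%:P)) + _] := sepG.
  rewrite -expr2 (eqp_dvdr _ iE) dvdp_exp2l// => /(_ isT).
  move=> /coprimepP/(_ ('X - b%:P)); rewrite dvdpp => /(_ isT isT).
  by rewrite -size_poly_eq1 size_XsubC.
move: iE; rewrite i1 expr1 => /eqpP[[c d] /= /andP[c0 d0] cG].
have G1 : c * v G'`_1 = d.
  by move/polyP: cG => /(_ 1%N); rewrite !coefZ coef_map coefB coefX coefC subr0 mulr1.
have G0 : c * v G'`_0 = - (d * b).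
  by move/polyP: cG => /(_ 0%N); rewrite !coefZ coef_map coefB coefX coefC sub0r mulrN.
have g1 : v G'`_1 != 0 by apply: contraNneq d0 => g; rewrite -G1 g mulr0.
exists (- (G'`_0 / G'`_1)); rewrite rmorphN fmorph_div; apply: (mulfI d0).
by rewrite mulrN -[X in - (X * _)]G1 mulrAC mulrA divfK// G0 opprK.
Qed.

Section SubfieldOfPredicate.
Variables (K : fieldType) (S : divringClosed K).

(** A subfield given by a predicate becomes a field type, so that gcds can be taken over it and
    [separable_pth_root] applies to its inclusion. *)
Record pred_subfield := PredSubfield {
  pred_subfield_val :> K; pred_subfieldP : pred_subfield_val \in S }.

HB.instance Definition _ := [isSub for pred_subfield_val].
HB.instance Definition _ := [Choice of pred_subfield by <:].
HB.instance Definition _ := [SubChoice_isSubIntegralDomain of pred_subfield by <:].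
HB.instance Definition _ := [SubIntegralDomain_isSubField of pred_subfield by <:].

Lemma polyOver_pred_subfield (P : {poly K}) : P \is a polyOver S ->
  exists P' : {poly pred_subfield}, P = map_poly val P'.
Proof.
move=> /polyOverP PS; exists (\poly_(i < size P) PredSubfield (PS i)).
apply/polyP => i; rewrite coef_map coef_poly; case: ltnP => // /leq_sizeP.
by move=> ->.
Qed.

End SubfieldOfPredicate.

Section SeparableExtension.
Variables (L K : fieldType) (iota : {rmorphism L -> K}) (p : nat).
Hypothesis pK : p \in [pchar K].

Lemma generated_field_divring d (t : 'I_d -> K) :
  divring_closed (fun x => `[< generated_field iota t x >]).
Proof.
pose ev : {rmorphism mpoly d L -> K} := mmap iota t.
split=> [|x y|x y]; rewrite !unfold_in.
- by apply/asboolP; exists 1, 1; rewrite !rmorph1 divr1 oner_eq0.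
- move=> /asboolP[P [Q [Q0 ->]]] /asboolP[P' [Q' [Q'0 ->]]]; apply/asboolP.
  exists (P * Q' - P' * Q), (Q * Q'); rewrite -!/(ev _) rmorphB !rmorphM /=.
  rewrite mulf_neq0//; split=> //.
  by rewrite -[X in _ + X]mulNr addf_div// mulNr.
move=> /asboolP[P [Q [Q0 ->]]] /asboolP[P' [Q' [Q'0 ->]]]; apply/asboolP.
(* By convention x / 0 = 0, so a vanishing divisor also needs a fraction, namely 0 / 1. *)
have [->|P'0] := eqVneq (ev P') 0.
  exists 0, 1; rewrite -!/(ev _) rmorph0 rmorph1 oner_eq0.
  by rewrite !mul0r invr0 mulr0.
exists (P * Q'), (Q * P'); rewrite -!/(ev _) !rmorphM /=.
by rewrite mulf_neq0//; split=> //; rewrite invf_div mulf_div.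
Qed.

(** Over L(t) the field K is separable algebraic, so [separable_pth_root] writes b = A(t) / B(t).
    Independence of t lifts b^p = a to A^p = a B^p in the polynomial ring, and the quotient of the
    leading coefficients is a p-th root of a in L. *)
Lemma separable_extension_pth_root (a : L) (b : K) :
  separable_extension iota -> iota a = b ^+ p -> exists a', a = a' ^+ p.
Proof.
move=> [d [t [tfree tsep]]] ab.
pose ev : {rmorphism mpoly d L -> K} := mmap iota t.
pose HS := GRing.isDivringClosed.Build _ _ (generated_field_divring t).
pose S : divringClosed K := HB.pack (fun x => `[< generated_field iota t x >]) HS.
have aS : b ^+ p \in S.
  apply/asboolP; exists (mpolyC d a), 1; rewrite -!/(ev _) rmorph1 oner_eq0.
  by split=> //; rewrite divr1 /ev /= mmapC.
have [P [PF sepP Pb]] := tsep b.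
have PS : P \is a polyOver S by apply/polyOverP => i; apply/asboolP.
have [P' P'E] := polyOver_pred_subfield PS; rewrite {}P'E in sepP Pb.
have [[b' /asboolP[A [B [B0 b'E]]]] /= bb'] :=
  separable_pth_root (beta := PredSubfield aS) pK sepP Pb erefl.
have BB : B != 0 by apply: contraNneq B0 => ->; rewrite -/(ev _) rmorph0.
have AB : A ^+ p = mpolyC d a * B ^+ p.
  apply/eqP; rewrite -subr_eq0; apply/eqP/tfree; rewrite -/(ev _).
  rewrite rmorphB rmorphM !rmorphXn /= mmapC.
  transitivity (ev A ^+ p - b ^+ p * ev B ^+ p); first by rewrite -ab.
  rewrite bb' b'E.
  by rewrite expr_div_n divfK ?subrr// expf_neq0.
exists (mleadc A / mleadc B); rewrite expr_div_n.
have lead (R : fieldType) e (Q : mpoly e R) (i : nat) :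
    mleadc (Q ^+ i) = mleadc Q ^+ i.
  have [->|Q0] := eqVneq Q 0; last first.
    by apply: mleadcX_proper; apply/lregP; rewrite mleadc_eq0.
  by case: i => [|i]; rewrite ?expr0 ?mleadc1// !expr0n /= mleadc0 expr0n.
rewrite -!lead AB mul_mpolyC mleadcZE.
by rewrite mulfK// mleadc_eq0 expf_neq0.
Qed.

End SeparableExtension.

(** * Rings of regular functions *)

Section RegularRings.
Variable k : fieldType.

(** A [kspace] only makes [regular_at] depend on germs. These are the remaining properties of a
    sheaf of local rings, to be established for each space that occurs. *)
Record regular_ring (X : kspace k) : Prop := {
  regular_cst : forall (x : X) c, regular_at x (fun=> c);
  regular_add : forall (x : X) phi psi, regular_at x phi -> regular_at x psi ->
    regular_at x (fun y => phi y + psi y);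
  regular_mul : forall (x : X) phi psi, regular_at x phi -> regular_at x psi ->
    regular_at x (fun y => phi y * psi y);
  regular_inv : forall (x : X) phi, regular_at x phi -> phi x != 0 ->
    regular_at x (fun y => (phi y)^-1);
  regular_neq0 : forall (x : X) phi, regular_at x phi -> phi x != 0 ->
    \forall y \near x, phi y != 0
}.

(** Closure holds only up to equality on the chart: on a toric variety a product of two characters
    is a character only at the points of the chart. *)
Definition chart_ring (T : Type) (C : set T * set (T -> k)) : Prop :=
  [/\ forall c, C.2 (fun=> c),
      forall f g, C.2 f -> C.2 g ->
        exists2 h, C.2 h & forall x, C.1 x -> h x = f x + g x &
      forall f g, C.2 f -> C.2 g ->
        exists2 h, C.2 h & forall x, C.1 x -> h x = f x * g x].

Lemma chart_ring_total (T : Type) (U : set T) (A : set (T -> k)) :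
  (forall c, A (fun=> c)) ->
  (forall f g, A f -> A g -> A (fun x => f x + g x)) ->
  (forall f g, A f -> A g -> A (fun x => f x * g x)) -> chart_ring (U, A).
Proof.
move=> A1 AD AM; split=> // f g Af Ag.
  by exists (fun x => f x + g x) => //; exact: AD.
by exists (fun x => f x * g x) => //; exact: AM.
Qed.

Section GluedRegularRing.
Variables (T : Type) (atlas : set (set T * set (T -> k))).
Let X := glued atlas.

Lemma basic_open (B : set X) : basic_opens atlas B -> open B.
Proof.
move=> aB; exists [set B]; last by rewrite bigcup_set1.
move=> A ->; exists [fset B]%fset; first by move=> A' /fset1P ->; apply/mem_set.
by rewrite set_fset1 bigcap_set1.
Qed.

(** Basic opens form a mere subbase, but a neighbourhood contains a finite intersection of them,
    which the filter absorbs. The intended filters are images of cofinite sets under a curve. *)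
Lemma glued_nbhs_sub (x : X) (G : set_system X) : Filter G ->
  (forall B, basic_opens atlas B -> B x -> G B) -> nbhs x `<=` G.
Proof.
move=> FG GB A; rewrite nbhsE => -[U [oU Ux] UA]; apply: (filterS UA).
have [I IB IE] := oU; move: Ux; rewrite -IE => -[V IV Vx].
have [D Db DE] := IB V IV.
apply: (@filterS _ _ _ V); first by move=> y Vy; exists V.
rewrite -DE; apply: filter_bigI => B BD; apply: GB.
  by have /set_mem := Db _ BD.
by move: Vx; rewrite -DE => /(_ B BD).
Qed.

Lemma near_basic (x : X) C (g : T -> k) :
  atlas C -> C.2 g -> C.1 x -> g x != 0 -> \forall y \near x, C.1 y /\ g y != 0.
Proof.
move=> aC Cg Cx gx; apply: open_nbhs_nbhs; split; last by split.
by apply: basic_open; exists C, g.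
Qed.

(** Change of chart at x: every germ of a fraction over [A] is also the germ of a fraction over
    [A']. *)
Definition refines (x : X) (A A' : set (T -> k)) : Prop :=
  forall f g, A f -> A g -> g x != 0 -> exists f' g',
    [/\ A' f', A' g', g' x != 0 & \forall y \near x, f y / g y = f' y / g' y].

Lemma refines_sub (x : X) (A A' : set (T -> k)) : A `<=` A' -> refines x A A'.
Proof.
by move=> AA f g Af Ag gx; exists f, g; split; [exact: AA|exact: AA|by []|near=> y].
Unshelve. all: by end_near. Qed.

Hypothesis atlas_cover : forall x : X, exists2 C, atlas C & C.1 x.
Hypothesis atlas_refine : forall (x : X) C C', atlas C -> atlas C' ->
  C.1 x -> C'.1 x ->
  exists C0, [/\ atlas C0, C0.1 x, chart_ring C0, refines x C.2 C0.2 &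
                 refines x C'.2 C0.2].

(** Two germs at x may come from different charts; once both are fractions over a common chart ring
    ([two]), the usual formulas for fractions apply. *)
Lemma glued_regular_ring : regular_ring (glued_space atlas).
Proof.
have two (x : X) phi psi : @regular_at _ (glued_space atlas) x phi ->
    @regular_at _ (glued_space atlas) x psi -> exists C f g f' g',
    [/\ atlas C, C.1 x, chart_ring C &
    [/\ [/\ C.2 f, C.2 g, C.2 f', C.2 g' & g x != 0 /\ g' x != 0],
    \forall y \near x, phi y = f y / g y & \forall y \near x, psi y = f' y / g' y]].
  move=> [C [f [g [aC Cf Cg [Cx gx] e]]]] [C' [f' [g' [aC' Cf' Cg' [Cx' gx'] e']]]].
  have [C0 [aC0 C0x r0 rC rC']] := atlas_refine aC aC' Cx Cx'.
  have [f0 [g0 [C0f C0g g0x e0]]] := rC f g Cf Cg gx.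
  have [f1 [g1 [C1f C1g g1x e1]]] := rC' f' g' Cf' Cg' gx'.
  exists C0, f0, g0, f1, g1; split=> //; split=> //.
    by near=> y; transitivity (f y / g y); near: y.
  by near=> y; transitivity (f' y / g' y); near: y.
split.
- move=> x c; have [C aC Cx] := atlas_cover x.
  have [C0 [aC0 C0x [r1 _ _] _ _]] := atlas_refine aC aC Cx Cx.
  exists C0, (fun=> c), (fun=> 1); split=> //; first by rewrite oner_eq0.
  by near=> y; rewrite divr1.
- move=> x phi psi p1 p2.
  have [C [f [g [f' [g' [aC Cx [r1 r2 r3] [[Cf Cg Cf' Cg' [gx gx']] e e']]]]]]] :=
    two _ _ _ p1 p2.
  have [h1 Ch1 h1E] := r3 _ _ Cf Cg'; have [h2 Ch2 h2E] := r3 _ _ Cf' Cg.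
  have [h3 Ch3 h3E] := r2 _ _ Ch1 Ch2; have [h4 Ch4 h4E] := r3 _ _ Cg Cg'.
  exists C, h3, h4; split=> //; first by rewrite h4E// mulf_neq0.
  have n1 := near_basic aC Cg Cx gx; have n2 := near_basic aC Cg' Cx gx'.
  near=> y; have -> : phi y = f y / g y by near: y.
  have -> : psi y = f' y / g' y by near: y.
  have [Cy gy] : C.1 y /\ g y != 0 by near: y.
  have [_ g'y] : C.1 y /\ g' y != 0 by near: y.
  by rewrite h3E// h1E// h2E// h4E// addf_div.
- move=> x phi psi p1 p2.
  have [C [f [g [f' [g' [aC Cx [r1 r2 r3] [[Cf Cg Cf' Cg' [gx gx']] e e']]]]]]] :=
    two _ _ _ p1 p2.
  have [h1 Ch1 h1E] := r3 _ _ Cf Cf'; have [h2 Ch2 h2E] := r3 _ _ Cg Cg'.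
  exists C, h1, h2; split=> //; first by rewrite h2E// mulf_neq0.
  have n1 := near_basic aC Cg Cx gx.
  near=> y; have [Cy _] : C.1 y /\ g y != 0 by near: y.
  rewrite h1E// h2E//; have -> : phi y = f y / g y by near: y.
  have -> : psi y = f' y / g' y by near: y.
  by rewrite mulf_div.
- move=> x phi [C [f [g [aC Cf Cg [Cx gx] e]]]] phix.
  exists C, g, f; split=> //.
    split=> //; move: phix; rewrite (nbhs_singleton e).
    by rewrite mulf_eq0 negb_or => /andP[].
  near=> y; have -> : phi y = f y / g y by near: y.
  by rewrite invf_div.
move=> x phi [C [f [g [aC Cf Cg [Cx gx] e]]]].
rewrite (nbhs_singleton e) mulf_eq0 invr_eq0 negb_or => /andP[fx _].
have n1 := near_basic aC Cg Cx gx; have n2 := near_basic aC Cf Cx fx.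
near=> y; have -> : phi y = f y / g y by near: y.
rewrite mulf_neq0 ?invr_eq0//; first by have [] : C.1 y /\ f y != 0 by near: y.
by have [] : C.1 y /\ g y != 0 by near: y.
Unshelve. all: by end_near. Qed.

End GluedRegularRing.

Lemma affine_space_regular_ring m : regular_ring (affine_space k m).
Proof.
apply: glued_regular_ring.
  by move=> x; eexists; first by rewrite /mkset; reflexivity.
move=> x C C' -> -> _ _; eexists.
split; [reflexivity|by []| |exact: refines_sub|exact: refines_sub].
apply: chart_ring_total => [c|f g [P ->] [Q ->]|f g [P ->] [Q ->]].
- by exists (mpolyC m c); apply/funext => x'; rewrite mevalC.
- by exists (P + Q); apply/funext => x'; rewrite mevalD.
- by exists (P * Q); apply/funext => x'; rewrite mevalM.
Qed.

Lemma near_val (X : topologicalType) (Z : set X) (z : set_type Z) (A : set X) :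
  (\forall x \near \val z, A x) -> \forall y \near z, A (\val y).
Proof. by move=> h; have := @initial_continuous _ _ (\val : Z -> X) z _ h. Qed.

Lemma open_near_val (X : topologicalType) (Z : set X) (z : set_type Z) (A : set Z) :
  nbhs z A -> \forall x \near \val z, forall Zx : Z x, A (SigSub (mem_set Zx)).
Proof.
rewrite nbhsE => -[U [[V oV VU] Uz] UA].
have Vz : V (\val z) by move: Uz; rewrite -VU.
apply: (filterS _ (open_nbhs_nbhs (conj oV Vz))) => x Vx Zx.
by apply: UA; rewrite -VU.
Qed.

Lemma subspace_regular_ring (X : kspace k) (Z : set X) :
  regular_ring X -> regular_ring (subspace Z).
Proof.
move=> rX; split.
- by move=> z c; hnf; exists (fun=> c); [exact: regular_cst|near=> y].
- move=> z phi psi [f rf e] [g rg e']; hnf; exists (fun x => f x + g x).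
    exact: regular_add.
  by near=> y; congr (_ + _); near: y.
- move=> z phi psi [f rf e] [g rg e']; hnf; exists (fun x => f x * g x).
    exact: regular_mul.
  by near=> y; congr (_ * _); near: y.
- move=> z phi [f rf e] fz; hnf; exists (fun x => (f x)^-1).
    by apply: regular_inv => //; rewrite -(nbhs_singleton e).
  by near=> y; congr (_ ^-1); near: y.
move=> z phi [f rf e] fz.
have /near_val n : \forall x \near \val z, f x != 0.
  by apply: regular_neq0 => //; rewrite -(nbhs_singleton e).
by near=> y; have -> : phi y = f (\val y); near: y.
Unshelve. all: by end_near. Qed.

Lemma kisomorphic_regular_ring (X Y : kspace k) :
  kisomorphic X Y -> regular_ring Y -> regular_ring X.
Proof.
move=> [f [g [[fc fr] [gc gr] fK gK]]] rY.
have tr x phi : regular_at x phi -> regular_at (f x) (phi \o g).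
  by move=> r; apply: gr; rewrite fK.
have rt x psi phi : regular_at (f x) psi -> psi \o f = phi -> regular_at x phi.
  by move=> /fr r <-.
split.
- by move=> x c; apply: (rt _ (fun=> c)) => //; exact: regular_cst.
- move=> x phi psi /tr r1 /tr r2; apply: (rt _ _ _ (regular_add rY r1 r2)).
  by apply/funext => y /=; rewrite !fK.
- move=> x phi psi /tr r1 /tr r2; apply: (rt _ _ _ (regular_mul rY r1 r2)).
  by apply/funext => y /=; rewrite !fK.
- move=> x phi /tr r1 nz; apply: (rt _ _ _ (regular_inv rY r1 _)); rewrite /= ?fK//.
  by apply/funext => y /=; rewrite fK.
move=> x phi /tr r1 nz; have := regular_neq0 rY r1; rewrite /= fK => /(_ nz) /fc /=.
by apply: (@filterS _ (nbhs x)) => y /=; rewrite fK.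
Qed.

(** Germs on an open subspace are the germs of the ambient space, so every property passes down to a
    chart and back up. *)
Lemma open_cover_regular_ring (X : kspace k) l (U : 'I_l -> set X) :
  (forall i, open (U i) /\ regular_ring (subspace (U i))) ->
  \bigcup_i U i = setT -> regular_ring X.
Proof.
move=> oU cU.
have chart (x : X) : exists (Z : set X) (z : Z),
    [/\ open Z, regular_ring (subspace Z) & \val z = x].
  have : setT x by []. rewrite -cU => -[i _ Ux].
  by exists (U i), (SigSub (mem_set Ux)); have [? ?] := oU i; split.
have down (Z : set X) (z : subspace Z) phi :
    regular_at (\val z) phi -> regular_at z (fun y : Z => phi (\val y)).
  by move=> r; hnf; exists phi => //; near=> y.
have up (Z : set X) (z : subspace Z) (phi : X -> k) : open Z ->
    regular_at z (fun y : Z => phi (\val y)) -> regular_at (\val z) phi.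
  move=> oZ [psi rpsi /open_near_val e]; apply: regular_germ rpsi.
  have oz : \forall x \near \val z, Z x.
    by apply: open_nbhs_nbhs; split=> //; exact/set_mem/valP.
  near=> x; have Zx : Z x by near: x.
  by have /(_ Zx) -> // : forall Zx : Z x, phi x = psi x by near: x.
split.
- by move=> x c; have [Z [z [oZ rZ <-]]] := chart x; apply: up => //; apply: (regular_cst rZ).
- move=> x phi psi; have [Z [z [oZ rZ <-]]] := chart x => /down r1 /down r2.
  by apply: up => //; apply: (regular_add rZ).
- move=> x phi psi; have [Z [z [oZ rZ <-]]] := chart x => /down r1 /down r2.
  by apply: up => //; apply: (regular_mul rZ).
- move=> x phi; have [Z [z [oZ rZ <-]]] := chart x => /down r1 nz.
  by apply: up => //; apply: (regular_inv rZ).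
move=> x phi; have [Z [z [oZ rZ <-]]] := chart x => /down r1 nz.
have /open_near_val e := regular_neq0 rZ r1 nz.
have oz : \forall x \near \val z, Z x.
  by apply: open_nbhs_nbhs; split=> //; exact/set_mem/valP.
near=> y; have Zy : Z y by near: y.
by have /(_ Zy) : forall Zx : Z y, phi y != 0 by near: y.
Unshelve. all: by end_near. Qed.

Lemma variety_regular_ring (X : kspace k) : is_variety X -> regular_ring X.
Proof.
move=> [_ _ [l [U [oU cU]]]]; apply: open_cover_regular_ring cU => i.
have [oUi [m [S iso]]] := oU i; split=> //; apply: (kisomorphic_regular_ring iso).
exact: subspace_regular_ring (affine_space_regular_ring m).
Qed.

End RegularRings.

(** * Products and function fields *)

Section ProductSpace.
Variable k : fieldType.

Section Product.
Variables X Y : kspace k.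
Hypotheses (rX : regular_ring X) (rY : regular_ring Y).

Let tensor (U : set X) (V : set Y) : set (X * Y -> k) :=
  [set h | exists l (a : 'I_l -> X -> k) (b : 'I_l -> Y -> k),
    (forall i, regular_on U (a i) /\ regular_on V (b i)) /\
    h = fun z => \sum_(i < l) a i z.1 * b i z.2].

Let tensor1 U V (a : X -> k) (b : Y -> k) :
  regular_on U a -> regular_on V b -> tensor U V (fun z => a z.1 * b z.2).
Proof.
move=> ra rb; exists 1%N, (fun=> a), (fun=> b); split=> //.
by apply/funext => z; rewrite big_ord1.
Qed.

Let tensor_ring U V : chart_ring (U `*` V, tensor U V).
Proof.
apply: chart_ring_total => [c|_ _ [l [a [b [r ->]]]] [l' [a' [b' [r' ->]]]]|
  _ _ [l [a [b [r ->]]]] [l' [a' [b' [r' ->]]]]].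
- have -> : (fun=> c) = (fun z : X * Y => (fun=> c) z.1 * (fun=> 1) z.2).
    by apply/funext => z; rewrite mulr1.
  by apply: (@tensor1 U V (fun=> c) (fun=> 1)) => z _; exact: regular_cst.
- exists (l + l')%N.
  exists (fun i => match fintype.split i with inl i => a i | inr i => a' i end).
  exists (fun i => match fintype.split i with inl i => b i | inr i => b' i end).
  split=> [i|]; first by case: (fintype.split i).
  apply/funext => z; rewrite big_split_ord /=; congr (_ + _).
    by apply: eq_bigr => i _; rewrite (unsplitK (inl _ i)).
  by apply: eq_bigr => i _; rewrite (unsplitK (inr _ i)).
exists #|{: 'I_l * 'I_l'}|.
exists (fun i => let j := enum_val i in fun x => a j.1 x * a' j.2 x).
exists (fun i => let j := enum_val i in fun x => b j.1 x * b' j.2 x).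
split=> [i|].
  split=> z zU; apply: regular_mul => //;
    by [apply: (r _).1|apply: (r' _).1|apply: (r _).2|apply: (r' _).2].
apply/funext => z; rewrite big_distrlr pair_big /=.
rewrite (reindex_onto (@enum_val _ _) enum_rank) /=; last first.
  by move=> i _; rewrite enum_rankK.
apply: eq_big => [i|i _]; first by rewrite enum_valK eqxx.
by rewrite mulrACA.
Qed.

Let prod_chart U V : open U -> open V ->
  [set C | exists (U : set X) (V : set Y), [/\ open U, open V, C.1 = U `*` V &
    C.2 = tensor U V]] (U `*` V, tensor U V).
Proof. by move=> oU oV; exists U, V. Qed.

Lemma prod_regular_ring : regular_ring (prod_space X Y).
Proof.
apply: glued_regular_ring => [x|x C C' [U [V [oU oV C1 C2]]] [U' [V' [oU' oV' C1' C2']]]].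
  by exists (setT `*` setT, tensor setT setT) => //; apply: prod_chart; exact: openT.
rewrite C1 C1' => -[Ux Vx] [U'x V'x].
exists ((U `&` U') `*` (V `&` V'), tensor (U `&` U') (V `&` V')); split.
- by apply: prod_chart; exact: openI.
- by [].
- exact: tensor_ring.
- apply: refines_sub; rewrite C2 => _ [l [a [b [r ->]]]]; exists l, a, b; split=> // i.
  by split=> z [Uz _]; [apply: (r i).1|apply: (r i).2].
apply: refines_sub; rewrite C2' => _ [l [a [b [r ->]]]]; exists l, a, b; split=> // i.
by split=> z [_ Uz]; [apply: (r i).1|apply: (r i).2].
Qed.

Lemma open_prod (U : set X) (V : set Y) :
  open U -> open V -> open (U `*` V : set (prod_space X Y)).
Proof.
move=> oU oV; apply: basic_open; exists (U `*` V, tensor U V), (fun=> 1).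
  by split; [exact: prod_chart|have [+ _ _] := tensor_ring U V; exact].
by apply/seteqP; split=> z; rewrite /= oner_eq0 => // -[].
Qed.

Lemma regular_on_prod (U : set X) (V : set Y) a b : open U -> open V ->
  regular_on U a -> regular_on V b ->
  regular_on (U `*` V : set (prod_space X Y)) (fun z => a z.1 * b z.2).
Proof.
move=> oU oV ra rb z UVz.
exists (U `*` V, tensor U V), (fun z => a z.1 * b z.2), (fun=> 1).
split.
- exact: prod_chart.
- exact: tensor1.
- by have [+ _ _] := tensor_ring U V; exact.
- by split=> //=; rewrite oner_eq0.
by near=> y; rewrite divr1.
Unshelve. all: by end_near. Qed.

Lemma open_fst (U : set X) : open U -> open (fst @^-1` U : set (prod_space X Y)).
Proof.
move=> oU; rewrite (_ : _ @^-1` _ = U `*` setT); first exact/open_prod/openT.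
by apply/seteqP; split=> z // -[].
Qed.

Lemma open_snd (V : set Y) : open V -> open (snd @^-1` V : set (prod_space X Y)).
Proof.
move=> oV; rewrite (_ : _ @^-1` _ = setT `*` V); first by apply: open_prod => //; exact: openT.
by apply/seteqP; split=> z // -[].
Qed.

Lemma regular_on_fst (U : set X) a : open U -> regular_on U a ->
  regular_on (fst @^-1` U : set (prod_space X Y)) (a \o fst).
Proof.
move=> oU ra z Uz.
rewrite (_ : a \o fst = fun z => a z.1 * (fun=> 1) z.2).
  apply: (@regular_on_prod U setT a (fun=> 1)) => //; first exact: openT.
  by move=> y _; exact: regular_cst.
by apply/funext => y; rewrite /= mulr1.
Qed.

Lemma regular_on_snd (V : set Y) b : open V -> regular_on V b ->
  regular_on (snd @^-1` V : set (prod_space X Y)) (b \o snd).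
Proof.
move=> oV rb z Vz.
rewrite (_ : b \o snd = fun z => (fun=> 1) z.1 * b z.2).
  apply: (@regular_on_prod setT V (fun=> 1) b) => //; first exact: openT.
  by move=> y _; exact: regular_cst.
by apply/funext => y; rewrite /= mul1r.
Qed.

End Product.
End ProductSpace.

Section RationalFunctions.
Variables (k : fieldType) (X : kspace k) (K : fieldType) (cls : (X -> k) -> K).
Hypotheses (rX : regular_ring X) (ffX : function_field cls).

Let rational_cst c : rational_fun (fun _ : X => c).
Proof.
exists setT; split; [exact: openT| |by move=> x _; exact: regular_cst].
by move=> O O0 oO; rewrite setIT.
Qed.

Lemma cls0 : cls (fun=> 0) = 0.
Proof.
apply: (addIr (cls (fun=> 0))); rewrite add0r -(ff_add ffX)//.
by congr cls; apply/funext => x; rewrite addr0.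
Qed.

Lemma cls_nat i : cls (fun=> i%:R) = i%:R.
Proof.
elim: i => [|i IHi]; first exact: cls0.
rewrite -[RHS]natr1 -IHi -(ff_one ffX) -(ff_add ffX)//.
by congr cls; apply/funext => x; rewrite natr1.
Qed.

(* A non-dense nonempty open set would have an indicator function that is a
   nontrivial idempotent of the function field. *)
Lemma function_field_dense (U : set X) : open U -> U !=set0 -> dense U.
Proof.
move=> oU [x0 Ux0]; pose e (x : X) : k := if `[< U x >] then 1 else 0.
have re : rational_fun e.
  exists (U `|` (~` U)°); split.
  - by apply: openU => //; exact: open_interior.
  - move=> O [x Ox] oO; have [OU|/nonemptyPn OU] := pselect ((O `&` U) !=set0).
      by have [y [Oy Uy]] := OU; exists y; split=> //; left.
    exists x; split=> //; right; rewrite /interior nbhsE; exists O => //.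
    by move=> y Oy Uy; have : set0 y by rewrite -OU.
  - move=> x [Ux|Ux].
      apply: (regular_germ _ (regular_cst rX x 1)).
      have oUx := open_nbhs_nbhs (conj oU Ux).
      by near=> y; rewrite /e asboolT//; near: y.
    apply: (regular_germ _ (regular_cst rX x 0)).
    by near=> y; rewrite /e asboolF//; near: y.
have : cls e * (cls e - 1) == 0.
  rewrite mulrBr mulr1 subr_eq0 -(ff_mul ffX)//; apply/eqP; congr cls.
  by apply/funext => x; rewrite /e; case: ifP; rewrite ?mulr1 ?mulr0.
rewrite mulf_eq0 subr_eq0 => /orP[/eqP e0|/eqP e1].
  rewrite -cls0 in e0; have /(ff_eq ffX)[] := e0; rewrite //.
  move=> D [oD dD De]; have [|y [Uy Dy]] := dD U _ oU; first by exists x0.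
  by have := De _ Dy; rewrite /e asboolT// => /eqP; rewrite oner_eq0.
rewrite -(ff_one ffX) in e1; have /(ff_eq ffX)[] := e1; rewrite //.
move=> D [oD dD De] O O0 oO; have [y [Oy Dy]] := dD O O0 oO.
exists y; split=> //; apply: contrapT => Uy.
by have := De _ Dy; rewrite /e asboolF// => /eqP; rewrite eq_sym oner_eq0.
Unshelve. all: by end_near. Qed.

Lemma rational_add phi psi : rational_fun phi -> rational_fun psi ->
  rational_fun (fun x : X => phi x + psi x).
Proof.
move=> [U [oU dU rU]] [V [oV dV rV]]; exists (U `&` V).
by split; [exact: openI|exact: denseI|move=> x [/rU + /rV]; exact: regular_add].
Qed.

Lemma rational_mul phi psi : rational_fun phi -> rational_fun psi ->
  rational_fun (fun x : X => phi x * psi x).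
Proof.
move=> [U [oU dU rU]] [V [oV dV rV]]; exists (U `&` V).
by split; [exact: openI|exact: denseI|move=> x [/rU + /rV]; exact: regular_mul].
Qed.

Lemma rational_open_neq0 phi : rational_fun phi -> exists U : set X,
  [/\ open U, dense U, regular_on U phi & open (U `&` [set x | phi x != 0])].
Proof.
move=> [U [oU dU rU]]; exists U; split=> //.
rewrite openE => x [Ux nz]; rewrite /interior.
by apply: filterI; [exact: open_nbhs_nbhs|apply: (regular_neq0 rX) => //; exact: rU].
Qed.

(** Where phi does not vanish is open, hence dense unless empty; if it is empty, the convention 0^-1
    = 0 makes the inverse the zero function. *)
Lemma rational_inv phi :
  rational_fun phi -> rational_fun (fun x : X => (phi x)^-1).
Proof.
move=> /rational_open_neq0[U [oU dU rU oN]].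
have [U0|/nonemptyPn U0] := pselect ((U `&` [set x | phi x != 0]) !=set0).
  exists (U `&` [set x | phi x != 0]); split=> //; first exact: function_field_dense.
  by move=> x [Ux nz]; apply: regular_inv => //; exact: rU.
exists U; split=> // x Ux; apply: (regular_germ _ (regular_cst rX x 0)).
have oUx := open_nbhs_nbhs (conj oU Ux).
near=> y; have -> : phi y = 0; last by rewrite invr0.
apply/eqP/negP => /negP nz; have : set0 y by rewrite -U0; split=> //; near: y.
by [].
Unshelve. all: by end_near. Qed.

Lemma rational_exp phi i :
  rational_fun phi -> rational_fun (fun x : X => phi x ^+ i).
Proof.
move=> r; elim: i => [|i IHi]; first exact: rational_cst.
rewrite (_ : (fun x => _) = fun x => phi x * phi x ^+ i); first exact: rational_mul.
by apply/funext => x; rewrite exprS.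
Qed.

Lemma rational_expz phi (i : int) :
  rational_fun phi -> rational_fun (fun x : X => phi x ^ i).
Proof.
by move=> r; case: i => i; [|apply: rational_inv]; exact: rational_exp.
Qed.

Lemma rational_prod (I : finType) (P : pred I) (phi : I -> X -> k) :
  (forall i, P i -> rational_fun (phi i)) ->
  rational_fun (fun x : X => \prod_(i | P i) phi i x).
Proof.
move=> r; rewrite (_ : (fun x => _) =
  \big[(fun f g x => f x * g x)/(fun=> 1)]_(i | P i) phi i).
  by apply: big_ind => //; exact: rational_mul.
apply/funext => x; rewrite (big_morph (fun f : X -> k => f x) (id1 := 1) (op1 := *%R))//.
Qed.

Lemma cls_exp phi i :
  rational_fun phi -> cls (fun x => phi x ^+ i) = cls phi ^+ i.
Proof.
move=> r; elim: i => [|i IHi]; first by rewrite expr0 -(ff_one ffX).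
rewrite exprS -IHi -(ff_mul ffX)//; last exact: rational_exp.
by congr cls; apply/funext => x; rewrite exprS.
Qed.

Lemma cls_congr phi psi : rational_fun psi -> generically_equal phi psi ->
  rational_fun phi /\ cls phi = cls psi.
Proof.
move=> rpsi [V [oV dV e]].
have rphi : rational_fun phi.
  have [U [oU dU rU]] := rpsi; exists (U `&` V).
  split; [exact: openI|exact: denseI|move=> x [Ux Vx]].
  apply: (regular_germ _ (rU x Ux)); have oVx := open_nbhs_nbhs (conj oV Vx).
  by near=> y; apply/esym/e; near: y.
by split=> //; apply/(ff_eq ffX) => //; exists V.
Unshelve. all: by end_near. Qed.

End RationalFunctions.

(** * Local rings of the affine line *)

Section RationalGerms.
Variable k : closedFieldType.

(** Replaces the Zariski topology on the parameter line of a curve, so that exceptional finite sets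
    are handled by [near]. *)
Definition cofin : set_system k :=
  [set A | exists S : seq k, forall s, s \notin S -> A s].

Global Instance cofin_filter : Filter cofin.
Proof.
split; first by exists [::].
  move=> A B [S SA] [T TB]; exists (S ++ T) => s.
  by rewrite mem_cat negb_or => /andP[/SA ? /TB].
by move=> A B AB [S SA]; exists S => s /SA /AB.
Qed.

Lemma cofin_neq (a : k) : \forall s \near cofin, s != a.
Proof. by exists [:: a] => s; rewrite inE. Qed.

Lemma cofin_horner (P : {poly k}) : P != 0 -> \forall s \near cofin, P.[s] != 0.
Proof.
move=> P0; have [r rE] := closed_field_poly_normal P.
exists r => s; rewrite -root_prod_XsubC; apply: contraNN => /eqP.
rewrite {1}rE hornerZ => /eqP; rewrite mulf_eq0 lead_coef_eq0 (negPf P0).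
by [].
Qed.

(** Multiplying P - Q by the product of X - z over the exceptional z gives a polynomial vanishing on
    all of k, which is zero because k is algebraically closed. *)
Lemma cofin_poly_eq (P Q : {poly k}) :
  (\forall s \near cofin, P.[s] = Q.[s]) -> P = Q.
Proof.
move=> [S SPQ]; pose E := (P - Q) * \prod_(z <- S) ('X - z%:P).
have : E == 0.
  apply: contraT => /closed_nonrootP[s]; rewrite rootM negb_or root_prod_XsubC.
  by move=> /andP[/rootP + /SPQ e]; rewrite hornerD hornerN e subrr.
rewrite mulf_eq0 subr_eq0 => /orP[/eqP //|].
by rewrite (negPf (monic_neq0 (monic_prod_XsubC _ _ _))).
Qed.

Lemma cofin_frac_eq (P Q P' Q' : {poly k}) : Q != 0 -> Q' != 0 ->
  (\forall s \near cofin, P.[s] / Q.[s] = P'.[s] / Q'.[s]) -> P * Q' = P' * Q.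
Proof.
move=> Q0 Q'0 e; apply: cofin_poly_eq.
have n := cofin_horner Q0; have n' := cofin_horner Q'0.
near=> s; rewrite !hornerM; apply/eqP; rewrite -eqr_div; [|by near: s..].
by apply/eqP; near: s.
Unshelve. all: by end_near. Qed.

Lemma horner_neq0 (Q : {poly k}) a : Q.[a] != 0 -> Q != 0.
Proof. by apply: contraNneq => ->; rewrite horner0. Qed.

(* The local ring of the affine line at a. *)
Definition germ_frac (a : k) (h : k -> k) : Prop := exists P Q : {poly k},
  [/\ Q.[a] != 0, h a = P.[a] / Q.[a] &
      \forall s \near cofin, h s = P.[s] / Q.[s]].

Lemma germ_frac_ext a h h' : h a = h' a ->
  (\forall s \near cofin, h s = h' s) -> germ_frac a h' -> germ_frac a h.
Proof.
move=> ha hh' [P [Q [Qa h'a e]]]; exists P, Q; split=> //; first by rewrite ha.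
by near=> s; transitivity (h' s); near: s.
Unshelve. all: by end_near. Qed.

Lemma germ_frac_horner a (P : {poly k}) : germ_frac a (horner P).
Proof.
exists P, 1; rewrite hornerC oner_eq0 divr1; split=> //.
by near=> s; rewrite hornerC divr1.
Unshelve. all: by end_near. Qed.

Lemma germ_frac_cst a c : germ_frac a (fun=> c).
Proof.
apply: germ_frac_ext (germ_frac_horner a c%:P); first by rewrite hornerC.
by near=> s; rewrite hornerC.
Unshelve. all: by end_near. Qed.

Lemma germ_frac_sub a b : germ_frac a (fun s => s - b).
Proof.
apply: germ_frac_ext (germ_frac_horner a ('X - b%:P)); first by rewrite hornerXsubC.
by near=> s; rewrite hornerXsubC.
Unshelve. all: by end_near. Qed.

Lemma germ_frac_add a h h' : germ_frac a h -> germ_frac a h' ->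
  germ_frac a (fun s => h s + h' s).
Proof.
move=> [P [Q [Qa ha e]]] [P' [Q' [Q'a h'a e']]]; exists (P * Q' + P' * Q), (Q * Q').
rewrite hornerD !hornerM mulf_neq0// ha h'a addf_div//; split=> //.
have n := cofin_horner (horner_neq0 Qa); have n' := cofin_horner (horner_neq0 Q'a).
near=> s; rewrite hornerD !hornerM -addf_div; [|by near: s..].
by congr (_ + _); near: s.
Unshelve. all: by end_near. Qed.

Lemma germ_frac_mul a h h' : germ_frac a h -> germ_frac a h' ->
  germ_frac a (fun s => h s * h' s).
Proof.
move=> [P [Q [Qa ha e]]] [P' [Q' [Q'a h'a e']]]; exists (P * P'), (Q * Q').
rewrite !hornerM mulf_neq0// ha h'a mulf_div; split=> //.
by near=> s; rewrite !hornerM -mulf_div; congr (_ * _); near: s.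
Unshelve. all: by end_near. Qed.

Lemma germ_frac_inv a h : germ_frac a h -> h a != 0 ->
  germ_frac a (fun s => (h s)^-1).
Proof.
move=> [P [Q [Qa ha e]]]; rewrite ha mulf_eq0 negb_or => /andP[Pa _].
exists Q, P; rewrite ha invf_div; split=> //.
by near=> s; rewrite -invf_div; congr (_^-1); near: s.
Unshelve. all: by end_near. Qed.

Lemma germ_frac_sum a (I : finType) (h : I -> k -> k) :
  (forall i, germ_frac a (h i)) -> germ_frac a (fun s => \sum_i h i s).
Proof.
move=> r; rewrite (_ : (fun s => _) = \big[(fun f g s => f s + g s)/(fun=> 0)]_i h i).
  by apply: big_ind => //; [exact: germ_frac_cst|exact: germ_frac_add].
apply/funext => x; rewrite (big_morph (fun f : k -> k => f x) (id1 := 0) (op1 := +%R))//.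
Qed.

Lemma germ_frac_prod a (I : finType) (P : pred I) (h : I -> k -> k) :
  (forall i, P i -> germ_frac a (h i)) ->
  germ_frac a (fun s => \prod_(i | P i) h i s).
Proof.
move=> r; rewrite (_ : (fun s => _) =
  \big[(fun f g s => f s * g s)/(fun=> 1)]_(i | P i) h i).
  by apply: big_ind => //; [exact: germ_frac_cst|exact: germ_frac_mul].
apply/funext => x; rewrite (big_morph (fun f : k -> k => f x) (id1 := 1) (op1 := *%R))//.
Qed.

Lemma germ_frac_expz a h (d : int) : germ_frac a h -> h a != 0 ->
  germ_frac a (fun s => h s ^ d).
Proof.
move=> r ha; have e (i : nat) : germ_frac a (fun s => h s ^+ i).
  elim: i => [|i IHi]; first exact: germ_frac_cst.
  apply: germ_frac_ext (germ_frac_mul r IHi); first by rewrite exprS.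
  by near=> s; rewrite exprS.
case: d => i; first exact: e.
by apply: germ_frac_inv; [exact: e|rewrite expf_neq0].
Unshelve. all: by end_near. Qed.

(** Cofinite agreement is an identity between polynomials, which can be evaluated at a as well, even
    if a is exceptional. *)
Lemma germ_frac_eq a h h' : germ_frac a h -> germ_frac a h' ->
  (\forall s \near cofin, h s = h' s) -> h a = h' a.
Proof.
move=> [P [Q [Qa -> e]]] [P' [Q' [Q'a -> e']]] hh'.
have /(congr1 (horner^~ a)) : P * Q' = P' * Q.
  apply: cofin_frac_eq (horner_neq0 Qa) (horner_neq0 Q'a) _.
  near=> s; transitivity (h s); first by apply: esym; near: s.
  by transitivity (h' s); near: s.
by rewrite !hornerM => e2; apply/eqP; rewrite eqr_div// e2.
Unshelve. all: by end_near. Qed.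

Lemma germ_frac_neq0 a h : germ_frac a h -> h a != 0 ->
  \forall s \near cofin, h s != 0.
Proof.
move=> [P [Q [Qa -> e]]]; rewrite mulf_eq0 negb_or => /andP[Pa _].
have n := cofin_horner (horner_neq0 Qa); have n' := cofin_horner (horner_neq0 Pa).
near=> s; have -> : h s = P.[s] / Q.[s] by near: s.
by rewrite mulf_neq0 ?invr_eq0//; near: s.
Unshelve. all: by end_near. Qed.

(* Up to finitely many values, h is a unit of the local ring at a. *)
Definition unit_germ (a : k) (h : k -> k) : Prop := exists h' : k -> k,
  [/\ germ_frac a h', h' a != 0 & \forall s \near cofin, h s = h' s].

Lemma germ_frac_unit a h : germ_frac a h -> h a != 0 -> unit_germ a h.
Proof. by move=> r ha; exists h; split=> //; near=> s. Unshelve. all: by end_near. Qed.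

Lemma unit_germ_ext a h h' :
  (\forall s \near cofin, h s = h' s) -> unit_germ a h' -> unit_germ a h.
Proof.
move=> e [f [rf fa e']]; exists f; split=> //.
by near=> s; transitivity (h' s); near: s.
Unshelve. all: by end_near. Qed.

Lemma unit_germ_mul a h h' : unit_germ a h -> unit_germ a h' ->
  unit_germ a (fun s => h s * h' s).
Proof.
move=> [f [rf fa e]] [f' [rf' f'a e']]; exists (fun s => f s * f' s).
split; [exact: germ_frac_mul|exact: mulf_neq0|].
by near=> s; congr (_ * _); near: s.
Unshelve. all: by end_near. Qed.

Lemma unit_germ_expz a h (d : int) : unit_germ a h -> unit_germ a (fun s => h s ^ d).
Proof.
move=> [f [rf fa e]]; exists (fun s => f s ^ d).
split; [exact: germ_frac_expz|exact: expfz_neq0|].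
by near=> s; congr (_ ^ _); near: s.
Unshelve. all: by end_near. Qed.

Lemma unit_germ_inv a h : unit_germ a h -> unit_germ a (fun s => (h s)^-1).
Proof.
move=> /(unit_germ_expz (-1)) u; apply: unit_germ_ext u.
by near=> s; rewrite exprN1.
Unshelve. all: by end_near. Qed.

Lemma unit_germ_prod_sub a (I : finType) (P : pred I) (b : I -> k) (d : I -> int) :
  (forall i, P i -> a != b i) -> unit_germ a (fun s => \prod_(i | P i) (s - b i) ^ d i).
Proof.
move=> ab; apply: germ_frac_unit.
  apply: germ_frac_prod => i Pi; apply: germ_frac_expz (germ_frac_sub a (b i)) _.
  by rewrite subr_eq0 ab.
by apply/prodf_neq0 => i Pi; rewrite expfz_neq0// subr_eq0 ab.
Qed.

Lemma unit_germ_frac a h : unit_germ a h -> exists P Q : {poly k},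
  [/\ P.[a] != 0, Q.[a] != 0 & \forall s \near cofin, h s = P.[s] / Q.[s]].
Proof.
move=> [f [[P [Q [Qa fa e]]] f0 e']]; exists P, Q; split=> //.
  by move: f0; rewrite fa mulf_eq0 negb_or => /andP[].
by near=> s; transitivity (f s); near: s.
Unshelve. all: by end_near. Qed.

(** In lowest terms h = P' / Q'. Being a unit at a makes a a root of both or of neither, and
    coprimality excludes both; over an algebraically closed field polynomials without roots are
    constant. *)
Lemma unit_germ_everywhere h : (forall a, unit_germ a h) ->
  exists2 c, c != 0 & \forall s \near cofin, h s = c.
Proof.
move=> uh; have [P [Q [P0 Q0 e]]] := unit_germ_frac (uh 0).
move: P0 Q0 => /horner_neq0 P0 /horner_neq0 Q0.
pose G := gcdp P Q; pose P' := P %/ G; pose Q' := Q %/ G.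
have PE : P = P' * G by rewrite divpK// dvdp_gcdl.
have QE : Q = Q' * G by rewrite divpK// dvdp_gcdr.
have G0 : G != 0 by rewrite gcdp_eq0 (negPf P0).
have P'0 : P' != 0 by apply: contraNneq P0; rewrite PE => ->; rewrite mul0r.
have Q'0 : Q' != 0 by apply: contraNneq Q0; rewrite QE => ->; rewrite mul0r.
have cPQ : coprimep P' Q' by rewrite coprimep_div_gcd// P0.
have e' : \forall s \near cofin, h s = P'.[s] / Q'.[s].
  have n := cofin_horner G0; near=> s.
  have -> : h s = P.[s] / Q.[s] by near: s.
  rewrite PE QE !hornerM -mulf_div divff ?mulr1//.
  by near: s.
have rt a : root P' a = root Q' a.
  have [R [S [Ra Sa f]]] := unit_germ_frac (uh a).
  have /(congr1 (root^~ a)) : R * Q' = P' * S.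
    apply: cofin_frac_eq (horner_neq0 Sa) Q'0 _.
    near=> s; transitivity (h s); first by apply: esym; near: s.
    by near: s.
  by rewrite !rootM /root (negPf Ra) (negPf Sa) orbF.
have nrt a : ~~ root P' a.
  apply/negP => ra; have := coprimep_root cPQ ra.
  by rewrite -/(root Q' a) -rt ra.
have s1 (R : {poly k}) : R != 0 -> (forall a, ~~ root R a) -> exists2 c, c != 0 & R = c%:P.
  move=> R0 nr; have [sR|/closed_rootP[a ra]] := eqVneq (size R) 1%N.
    by have /eqP/size_poly1P := sR.
  by have := nr a; rewrite ra.
have [c c0 cE] := s1 P' P'0 nrt.
have [d d0 dE] := s1 Q' Q'0 (fun a => eq_ind _ (fun b => ~~ b) (nrt a) _ (rt a)).
exists (c / d); first by rewrite mulf_neq0 ?invr_eq0.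
by near=> s; have -> : h s = P'.[s] / Q'.[s]; [near: s|rewrite cE dE !hornerC].
Unshelve. all: by end_near. Qed.

Lemma unit_germ0_expz (d : int) : unit_germ 0 (fun s : k => s ^ d) -> d = 0.
Proof.
move=> /unit_germ_frac[P [Q [P0 Q0]]]; case: d => [[|i]|i] // e.
  have : 'X^(i.+1) * Q = P * 1.
    apply: cofin_frac_eq; rewrite ?oner_eq0 ?(horner_neq0 Q0)//.
    near=> s; rewrite hornerXn hornerC divr1; by near: s.
  move=> /(congr1 (horner^~ 0)); rewrite !hornerE expr0n mul0r.
  by move=> /esym/eqP; rewrite (negPf P0).
have : 1 * Q = P * 'X^(i.+1).
  apply: cofin_frac_eq (monic_neq0 (monicXn _ _)) (horner_neq0 Q0) _.
  by near=> s; rewrite hornerXn hornerC div1r; near: s.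
by move=> /(congr1 (horner^~ 0)); rewrite !hornerE expr0n mulr0 => /eqP; rewrite (negPf Q0).
Unshelve. all: by end_near. Qed.

(** * Germs and orders along a parametrized curve *)

Section CurveGerm.
Variables (T : Type) (atlas : set (set T * set (T -> k))) (gamma : k -> T) (a : k).
Let X := glued_space atlas.
Hypothesis chart_germ : forall C, atlas C -> C.1 (gamma a) ->
  (\forall s \near cofin, C.1 (gamma s)) /\
  forall f, C.2 f -> germ_frac a (f \o gamma).

Lemma curve_near (A : set X) : nbhs (gamma a : X) A ->
  \forall s \near cofin, A (gamma s).
Proof.
apply: (@glued_nbhs_sub _ _ atlas (gamma a) (gamma @ cofin)).
move=> _ [C [g [aC Cg] ->]] [Ca ga]; have [nC rC] := chart_germ aC Ca.
have n := germ_frac_neq0 (rC _ Cg) ga.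
by near=> s; split; near: s.
Unshelve. all: by end_near. Qed.

Lemma curve_germ (phi : X -> k) : regular_at (gamma a : X) phi ->
  germ_frac a (phi \o gamma).
Proof.
move=> [C [f [g [aC Cf Cg [Ca ga] e]]]]; have [_ rC] := chart_germ aC Ca.
have := germ_frac_mul (rC _ Cf) (germ_frac_inv (rC _ Cg) ga).
by apply: germ_frac_ext; [exact: (nbhs_singleton e)|exact: (curve_near e)].
Qed.

(** Since t generates the maximal ideal, tau = t psi. With t = A / B and psi = C / D along the curve
    this reads (X - a) B D = A C, and A vanishes at a; cancelling X - a shows that A has a simple
    zero. Thus t is a unit times s - a. *)
Lemma curve_order (tau g : X -> k) (d : int) :
  regular_at (gamma a : X) tau -> (forall s, tau (gamma s) = s - a) ->
  has_order (gamma a : X) g d -> unit_germ a (fun s => g (gamma s) / (s - a) ^ d).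
Proof.
move=> rtau tauE [t [u [[rt ta tmax] ru ua /curve_near gE]]].
have [psi rpsi /curve_near psiE] : exists2 psi, regular_at (gamma a : X) psi &
    \forall y \near (gamma a : X), tau y = t y * psi y.
  by apply: tmax => //; rewrite tauE subrr.
have [A [B [Ba tA tE]]] := curve_germ rt.
have [C [D [Da _ pE]]] := curve_germ rpsi.
have Aa : root A a.
  apply/rootP/eqP; move: tA; rewrite /= ta => /esym/eqP.
  by rewrite mulf_eq0 invr_eq0 (negPf Ba) orbF.
have /factor_theorem [A' A'E] := Aa.
have A'a : A'.[a] != 0.
  have eq1 : ('X - a%:P) * (B * D) = A * C * 1.
    apply: cofin_frac_eq; rewrite ?oner_eq0 ?mulf_neq0 ?(horner_neq0 Ba) ?(horner_neq0 Da)//.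
    near=> s; rewrite hornerXsubC hornerC divr1 -tauE !hornerM -mulf_div.
    transitivity (t (gamma s) * psi (gamma s)); first by near: s.
    by congr (_ * _); near: s.
  have : B * D = A' * C.
    apply: (@mulfI _ ('X - a%:P)); first by rewrite polyXsubC_eq0.
    by rewrite eq1 mulr1 A'E mulrAC mulrC.
  move=> /(congr1 (horner^~ a)); rewrite !hornerM => e.
  by have := mulf_neq0 Ba Da; rewrite e mulf_eq0 negb_or => /andP[].
have uq : unit_germ a (fun s => A'.[s] / B.[s]).
  apply: germ_frac_unit; last by rewrite mulf_neq0 ?invr_eq0.
  apply: germ_frac_mul (germ_frac_horner _ _) _.
  exact: germ_frac_inv (germ_frac_horner _ _) _.
have uu := germ_frac_unit (curve_germ ru) ua.
apply: unit_germ_ext (unit_germ_mul uu (unit_germ_expz d uq)).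
have na := cofin_neq a.
near=> s; have sa : s != a by near: s.
have -> : g (gamma s) = u (gamma s) * t (gamma s) ^ d.
  (* The formula for [g] holds off the point only; [tau] shows that gamma s differs from gamma a
     when s differs from a. *)
  apply: (near gE s) => //; apply/eqP => gs.
  have := tauE s; rewrite gs tauE subrr => /esym/eqP; rewrite subr_eq0.
  exact/negP.
have -> : t (gamma s) = A'.[s] / B.[s] * (s - a).
  rewrite mulrAC; transitivity (A.[s] / B.[s]); first by near: s.
  by rewrite A'E hornerM hornerXsubC.
by rewrite expfzMl mulrA mulfK ?expfz_neq0 ?subr_eq0.
Unshelve. all: by end_near. Qed.

End CurveGerm.
End RationalGerms.

Arguments cofin : clear implicits.

(** * The projective line *)

Section ProjectiveLine.
Variable k : closedFieldType.

Let P1 : kspace k := proj_line k.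

Definition affine_coord (x : option k) : k := if x is Some a then a else 0.
Let coord_inf (x : option k) : k := if x is Some a then a^-1 else 0.

Let chart0 : set (option k) * set (option k -> k) :=
  ([set x | x != None], [set f | exists P : {poly k}, f = fun x => P.[affine_coord x]]).
Let chart_inf : set (option k) * set (option k -> k) :=
  ([set x | x != Some 0], [set f | exists P : {poly k}, f = fun x => P.[coord_inf x]]).
Let atlas := [set chart0; chart_inf].

Lemma horner_inv (P : {poly k}) : exists (R : {poly k}) (N : nat),
  forall s, s != 0 -> P.[s^-1] = R.[s] / s ^+ N.
Proof.
elim/poly_ind: P => [|P c [R [N RE]]].
  by exists 0, 0%N => s _; rewrite !horner0 mul0r.
exists (R + c *: 'X^(N.+1)), N.+1 => s s0; rewrite hornerMXaddC RE// !hornerE.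
by rewrite mulrDl mulfK ?expf_neq0// exprSr invfM !mulrA.
Qed.

Let chart0_ring : chart_ring chart0.
Proof.
apply: chart_ring_total => [c|_ _ [P ->] [Q ->]|_ _ [P ->] [Q ->]].
- by exists c%:P; apply/funext => x; rewrite hornerC.
- by exists (P + Q); apply/funext => x; rewrite hornerD.
- by exists (P * Q); apply/funext => x; rewrite hornerM.
Qed.

Let chart_inf_ring : chart_ring chart_inf.
Proof.
apply: chart_ring_total => [c|_ _ [P ->] [Q ->]|_ _ [P ->] [Q ->]].
- by exists c%:P; apply/funext => x; rewrite hornerC.
- by exists (P + Q); apply/funext => x; rewrite hornerD.
- by exists (P * Q); apply/funext => x; rewrite hornerM.
Qed.

Lemma open_affine_part : open ([set x | x != None] : set P1).
Proof.
apply: basic_open; exists chart0, (fun=> 1).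
  by split; [left|have [+ _ _] := chart0_ring; exact].
by apply/seteqP; split=> x; rewrite /= oner_eq0 // => -[].
Qed.

Let refine_inf0 (a : k) : a != 0 ->
  @refines _ _ atlas (Some a) chart_inf.2 chart0.2.
Proof.
move=> a0 _ _ [P ->] [Q ->] Qa.
have [R [N RE]] := horner_inv P; have [S [M SE]] := horner_inv Q.
(* P(1/s) / Q(1/s) = (R(s) / s^N) / (S(s) / s^M) = R(s) s^M / (S(s) s^N). *)
exists (fun x => (R * 'X^M).[affine_coord x]), (fun x => (S * 'X^N).[affine_coord x]).
split; [by eexists|by eexists| |].
  move: Qa; rewrite /= SE// hornerM hornerXn !mulf_eq0 !negb_or => /andP[-> _].
  by rewrite expf_neq0.
have : \forall x \near (Some a : glued atlas), x != None /\ affine_coord x != 0.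
  apply: (@near_basic _ _ atlas (Some a) chart0 affine_coord) => //; first by left.
  by exists 'X; apply/funext => x; rewrite hornerX.
apply: filterS => -[s|] [] //= _ s0; rewrite RE// SE// !hornerM !hornerXn.
by rewrite invfM invrK mulrACA -[RHS]mulf_div [X in _ = _ * X]mulrC.
Qed.

Lemma proj_line_regular_ring : regular_ring P1.
Proof.
apply: (@glued_regular_ring _ _ atlas) => [[a|]|].
- by exists chart0; [left|].
- by exists chart_inf; [right|].
move=> x C C' aC aC' Cx C'x.
case: x Cx C'x => [a|] Cx C'x; last first.
  case: aC Cx => -> // _; case: aC' C'x => -> // _.
  by exists chart_inf; split=> //; [right|exact: refines_sub|exact: refines_sub].
have r0 C0 : atlas C0 -> C0.1 (Some a) -> @refines _ _ atlas (Some a) C0.2 chart0.2.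
  move=> [->|->] C0a; first exact: refines_sub.
  by apply: refine_inf0; apply: contraNneq C0a => ->.
by exists chart0; split=> //; [left|exact: r0|exact: r0].
Qed.

Lemma affine_coord_regular : regular_on ([set x | x != None] : set P1) affine_coord.
Proof.
move=> x x0; exists chart0, affine_coord, (fun=> 1); split.
- by left.
- by exists 'X; apply/funext => y; rewrite hornerX.
- by have [+ _ _] := chart0_ring; exact.
- by rewrite oner_eq0.
by near=> y; rewrite divr1.
Unshelve. all: by end_near. Qed.

Let germ_frac_horner_comp a (P : {poly k}) h :
  germ_frac a h -> germ_frac a (fun s => P.[h s]).
Proof.
move=> r; elim/poly_ind: P => [|P c IHP].
  apply: germ_frac_ext (germ_frac_cst a 0); first by rewrite horner0.
  by near=> s; rewrite horner0.
apply: germ_frac_ext (germ_frac_add (germ_frac_mul IHP r) (germ_frac_cst a c)).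
  by rewrite hornerMXaddC.
by near=> s; rewrite hornerMXaddC.
Unshelve. all: by end_near. Qed.

Let id_germ (a : k) : germ_frac a id.
Proof.
apply: germ_frac_ext (germ_frac_horner a 'X); first by rewrite hornerX.
by near=> s; rewrite hornerX.
Unshelve. all: by end_near. Qed.

Lemma affine_chart_germ (a : k) C : atlas C -> C.1 (Some a) ->
  (\forall s \near cofin k, C.1 (Some s)) /\
  forall f, C.2 f -> germ_frac a (f \o Some).
Proof.
move=> [->|->] /= Ca.
  by split=> [|_ [P ->]]; [near=> s|exact: germ_frac_horner].
have a0 : a != 0 by apply: contraNneq Ca => ->.
split=> [|_ [P ->] /=].
  have n := cofin_neq (0 : k); near=> s.
  have s0 : s != 0 by near: s.
  by apply: contra_neq s0 => -[].
apply: germ_frac_horner_comp; exact: germ_frac_inv.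
Unshelve. all: by end_near. Qed.

(** The coordinate at infinity, read as a curve through [None] at s = 0. *)
Definition line_at_infinity (s : k) : option k := if s == 0 then None else Some s^-1.

Lemma infinity_chart_germ C : atlas C -> C.1 (line_at_infinity 0) ->
  (\forall s \near cofin k, C.1 (line_at_infinity s)) /\
  forall f, C.2 f -> germ_frac 0 (f \o line_at_infinity).
Proof.
have cK s : coord_inf (line_at_infinity s) = s.
  by rewrite /line_at_infinity; case: eqP => [->|_] //=; rewrite invrK.
move=> [->|->] /= Ca; first by move: Ca; rewrite /line_at_infinity !eqxx.
split=> [|_ [P ->] /=].
  near=> s; rewrite /line_at_infinity; have [//|s0] := eqVneq s 0.
  by apply: contra_neq s0 => -[] /eqP; rewrite invr_eq0 => /eqP.
have -> : (fun x => P.[coord_inf x]) \o line_at_infinity = horner P.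
  by apply/funext => s /=; rewrite cK.
exact: germ_frac_horner.
Unshelve. all: by end_near. Qed.

Let affine_order (a : k) (g : P1 -> k) (d : int) : has_order (Some a : P1) g d ->
  unit_germ a (fun s => g (Some s) / (s - a) ^ d).
Proof.
apply: (@curve_order _ _ atlas Some a (@affine_chart_germ a)
  (fun x => affine_coord x - a)) => //.
exists chart0, (fun x => affine_coord x - a), (fun=> 1); split.
- by left.
- by exists ('X - a%:P); apply/funext => y; rewrite hornerXsubC.
- by have [+ _ _] := chart0_ring; exact.
- by rewrite oner_eq0.
by near=> y; rewrite divr1.
Unshelve. all: by end_near. Qed.

Let infinity_order (g : P1 -> k) (d : int) : has_order (None : P1) g d ->
  unit_germ 0 (fun s => g (line_at_infinity s) / s ^ d).
Proof.
have e0 : line_at_infinity 0 = None by rewrite /line_at_infinity eqxx.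
rewrite -{}e0 => gd.
have rw : regular_at (line_at_infinity 0 : P1) coord_inf.
  exists chart_inf, coord_inf, (fun=> 1); split.
  - by right.
  - by exists 'X; apply/funext => y; rewrite hornerX.
  - by have [+ _ _] := chart_inf_ring; exact.
  - by rewrite oner_eq0 /line_at_infinity eqxx.
  by near=> y; rewrite divr1.
have cE s : coord_inf (line_at_infinity s) = s - 0.
  by rewrite subr0 /line_at_infinity; case: eqP => [->|_] //=; rewrite invrK.
apply: unit_germ_ext (@curve_order _ _ atlas _ _ (@infinity_chart_germ) _ _ _ rw cE gd).
by near=> s; rewrite subr0.
Unshelve. all: by end_near. Qed.

Let cofin_inv (A : set k) : cofin k A -> \forall s \near cofin k, A s^-1.
Proof.
move=> [S SA]; exists (map GRing.inv S) => s sS; apply: SA.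
by apply: contraNN sS => sS; apply/mapP; exists s^-1; rewrite ?invrK.
Qed.

(** Divided by the product [N] of its linear factors at the finite marked points, g is a unit at
    every finite point, hence constant. The order at infinity then shows that the degree is zero. *)
Lemma proj_line_function l (p : 'I_l -> P1) (d : 'I_l -> int) (g : P1 -> k) :
  injective p -> (forall j, has_order (p j) g (d j)) ->
  (forall x, (forall j, x <> p j) -> regular_at x g /\ g x != 0) ->
  \sum_j d j = 0 /\ exists2 c, c != 0 &
    forall s, (forall j, Some s <> p j) -> g (Some s) =
      c * \prod_(j | isSome (p j : option k)) (s - affine_coord (p j)) ^ d j.
Proof.
move=> pI gord greg.
pose S j := isSome (p j : option k).
have pE j : S j -> p j = Some (affine_coord (p j)) :> option k.
  by rewrite /S; case: (p j : option k).
pose N s := \prod_(j | S j) (s - affine_coord (p j)) ^ d j.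
have germ s : (forall j, Some s <> p j) ->
    germ_frac s (fun t => g (Some t)) /\ g (Some s) != 0.
  move=> /greg [rg gs]; split=> //.
  exact: (@curve_germ _ _ atlas Some s (@affine_chart_germ s) g rg).
have uN x : (forall j, S j -> x != affine_coord (p j)) -> unit_germ x N.
  exact: unit_germ_prod_sub.
have [c c0 gE] : exists2 c, c != 0 & \forall s \near cofin k, g (Some s) / N s = c.
  apply: unit_germ_everywhere => x.
  have [[j jx]|nx] := pselect (exists j, p j = Some x).
    have xE : x = affine_coord (p j) by rewrite jx.
    have := gord j; rewrite {1}jx => /affine_order u1.
    have u2 : unit_germ x (fun s =>
        \prod_(i | S i && (i != j)) (s - affine_coord (p i)) ^ d i).
      apply: unit_germ_prod_sub => i /andP[Si ij]; apply: contra_neq ij => xi.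
      by apply: pI; rewrite (pE i Si) -xi.
    apply: unit_germ_ext (unit_germ_mul u1 (unit_germ_inv u2)).
    near=> s; rewrite /N (bigD1 j) /=; last by rewrite /S jx.
    by rewrite invfM mulrA -xE.
  have xn j : Some x <> p j by move=> xj; apply: nx; exists j.
  have [g1 g2] := germ _ xn.
  apply: unit_germ_mul (germ_frac_unit g1 g2) (unit_germ_inv (uN _ _)) => j Sj.
  by apply/eqP => xj; apply: (xn j); rewrite (pE j Sj) xj.
have nN : \forall s \near cofin k, N s != 0.
  have : \forall s \near cofin k, s \notin [seq affine_coord (p j) | j : 'I_l].
    by exists [seq affine_coord (p j) | j : 'I_l].
  apply: filterS => s sn; apply/prodf_neq0 => j _; rewrite expfz_neq0// subr_eq0.
  by apply: contraNneq sn => ->; apply/mapP; exists j; rewrite ?mem_enum.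
have gN : \forall s \near cofin k, g (Some s) = c * N s.
  near=> s; have <- : g (Some s) / N s = c by near: s.
  by rewrite divfK//; near: s.
split; last first.
  exists c => // s sn; have [rg gs] := germ s sn.
  (* Both sides are regular at every unmarked s, so the identity extends from cofinitely many s to
     all of these. *)
  apply: (germ_frac_eq rg) gN; apply: germ_frac_mul (germ_frac_cst _ _) _.
  apply: germ_frac_prod => j Sj; apply: germ_frac_expz (germ_frac_sub _ _) _.
  by rewrite subr_eq0; apply/eqP => sj; apply: (sn j); rewrite (pE j Sj) -sj.
(* The order of g at infinity: by injectivity at most one marking lies there, and without one g is a
   unit there. *)
pose e := \sum_(j | ~~ S j) d j.
have uinf : unit_germ 0 (fun s => g (line_at_infinity s) / s ^ e).
  have [[j jx]|nx] := pselect (exists j, p j = None).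
    have -> : e = d j.
      rewrite /e (big_pred1 j) // => i; apply/idP/eqP => [|->]; last by rewrite /S jx.
      move=> Si; apply: pI; rewrite jx; move: Si; rewrite /S.
      by case: (p i : option k).
    by have := gord j; rewrite jx => /infinity_order.
  have -> : e = 0.
    rewrite /e big_pred0 // => i; apply/negbF.
    by rewrite /S; case E : (p i : option k) => //; case: nx; exists i.
  have e0 : line_at_infinity 0 = None by rewrite /line_at_infinity eqxx.
  have [rg g0] : regular_at (line_at_infinity 0 : P1) g /\ g (line_at_infinity 0) != 0.
    by apply: greg => j; rewrite e0 => pj; apply: nx; exists j.
  have := germ_frac_unit
    (@curve_germ _ _ atlas line_at_infinity 0 (@infinity_chart_germ) g rg) g0.
  by apply: unit_germ_ext; near=> s; rewrite expr0z divr1.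
(* At infinity each factor s^-1 - p_j equals (1 - p_j s) / s, with a numerator that is a unit at s =
   0; what remains is a power of s. *)
have uprod : unit_germ 0 (fun s => c * \prod_(j | S j) (1 - affine_coord (p j) * s) ^ d j).
  apply: germ_frac_unit; last first.
    by rewrite mulf_neq0//; apply/prodf_neq0 => j _; rewrite mulr0 subr0 exp1rz oner_eq0.
  apply: germ_frac_mul (germ_frac_cst _ _) _; apply: germ_frac_prod => j _.
  apply: germ_frac_expz; last by rewrite mulr0 subr0 oner_eq0.
  apply: germ_frac_ext (germ_frac_horner 0 (1 - affine_coord (p j) *: 'X)).
    by rewrite !hornerE.
  by near=> s; rewrite !hornerE.
have : unit_germ 0 (fun s : k => s ^ (- (\sum_(j | S j) d j + e))).
  apply: unit_germ_ext (unit_germ_mul uinf (unit_germ_inv uprod)).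
  have gN' := cofin_inv gN; have n0 := cofin_neq (0 : k).
  have nN' := cofin_inv nN.
  near=> s; have s0 : s != 0 by near: s.
  have -> : line_at_infinity s = Some s^-1 by rewrite /line_at_infinity (negPf s0).
  have -> : g (Some s^-1) = c * N s^-1 by near: s.
  have NE : N s^-1 =
      \prod_(j | S j) (1 - affine_coord (p j) * s) ^ d j / s ^ (\sum_(j | S j) d j).
    have -> : s ^ (\sum_(j | S j) d j) = \prod_(j | S j) s ^ d j.
      by apply: (big_morph (fun i : int => s ^ i)) => // i i'; rewrite expfzDr.
    rewrite -prodf_div; apply: eq_bigr => j _.
    have -> : 1 - affine_coord (p j) * s = (s^-1 - affine_coord (p j)) * s.
      by rewrite mulrBl mulVf.
    by rewrite expfzMl mulfK ?expfz_neq0.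
  have Ns : N s^-1 != 0 by near: s.
  move: Ns; rewrite NE mulf_eq0 negb_or => /andP[Pn _].
  rewrite -invr_expz expfzDr// !mulrA -[c * _ / _ / _]mulrA -invfM.
  by rewrite mulrAC mulfV ?mul1r// mulf_neq0.
move=> /unit_germ0_expz /eqP; rewrite oppr_eq0 => /eqP.
by move=> D0; rewrite (bigID S).
Unshelve. all: by end_near. Qed.

End ProjectiveLine.

(** * Weights and contact orders *)

Section Weights.
Variables (n : nat) (q : 'I_n.+1 -> nat).
Hypothesis wf : well_formed q.

Let q_gt0 i : (0 < q i)%N. Proof. by have [_ + _] := wf; exact. Qed.

Let q_neq0 i : (q i)%:R != 0 :> rat. Proof. by rewrite pnatr_eq0 -lt0n. Qed.

(** These tuples are the characters, through a_i = <m, e_i>: the relation sum_i q_i e_i = 0 imposes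
    exactly this condition. *)
Definition weight_relation (a : 'I_n.+1 -> int) : Prop := \sum_i (q i)%:Z * a i = 0.

(** The values of the linear form are an ideal of the integers containing the gcd of the weights
    other than q_j, which is 1 by well-formedness. *)
Lemma bezout_weights (j : 'I_n.+1) (x : int) :
  exists b : 'I_n.+1 -> int, \sum_(i | i != j) (q i)%:Z * b i = x.
Proof.
pose S (y : int) := exists b : 'I_n.+1 -> int, \sum_(i | i != j) (q i)%:Z * b i = y.
have SM y z : S y -> S (y * z).
  move=> [b <-]; exists (fun i => b i * z).
  by rewrite mulr_suml; apply: eq_bigr => i _; rewrite mulrA.
have SD y z : S y -> S z -> S (y + z).
  move=> [b <-] [c <-]; exists (fun i => b i + c i).
  by rewrite -big_split; apply: eq_bigr => i _; rewrite mulrDr.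
have S1 : S (\big[gcdn/0]_(i | i != j) q i)%:Z.
  apply: (big_ind (fun y : nat => S y%:Z)) => [|y z Sy Sz|i ij].
  - by exists (fun=> 0); rewrite big1// => i _; rewrite mulr0.
  - have [u [v uv]] := Bezoutz y z; have -> : (gcdn y z)%:Z = gcdz y z by [].
    by rewrite -uv; apply: SD; rewrite mulrC; exact: SM.
  exists (fun i' => (i' == i)%:Z); rewrite (bigD1 i)//= eqxx mulr1 big1 ?addr0//.
  by move=> i' /andP[_ /negPf ->]; rewrite mulr0.
by have := SM _ x S1; have [_ _ ->] := wf; rewrite mul1r.
Qed.

Lemma weight_relation_at (j : 'I_n.+1) (y : int) (b : 'I_n.+1 -> int) :
  \sum_(i | i != j) (q i)%:Z * b i = - ((q j)%:Z * y) ->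
  weight_relation (fun i => if i == j then y else b i).
Proof.
move=> bE; rewrite /weight_relation (bigD1 j)//= eqxx.
apply/eqP; rewrite addr_eq0 eq_sym eqr_oppLR -bE; apply/eqP.
by apply: eq_bigr => i /negPf ->.
Qed.

Lemma weight_relation_pair (i j : 'I_n.+1) (x y : int) : i != j ->
  (q i)%:Z * x + (q j)%:Z * y = 0 ->
  weight_relation (fun h => if h == i then x else if h == j then y else 0).
Proof.
move=> ij xy; rewrite /weight_relation (bigD1 i)//= eqxx (bigD1 j)/=; last by rewrite eq_sym.
rewrite eqxx eq_sym (negPf ij) big1 ?addr0// => h /andP[/negPf -> /negPf ->].
by rewrite mulr0.
Qed.

Section ContactOrders.
Variables (l : nat) (alpha : 'I_l -> 'I_n.+1 -> rat).
Hypothesis alpha_ge0 : forall h i, 0 <= alpha h i.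
Hypothesis alpha_uniq : forall i h h', 0 < alpha h i -> 0 < alpha h' i -> h = h'.
(** The pairing <m, c_h> of the h-th contact order with the character m that has values [a] on the
    rays. *)
Let deg (a : 'I_n.+1 -> int) h : rat := \sum_i alpha h i * (a i)%:~R.
Hypothesis deg_int : forall a, weight_relation a -> forall h, deg a h \is a Num.int.
Hypothesis deg_sum0 : forall a, weight_relation a -> \sum_h deg a h = 0.

Let deg_pair (i j : 'I_n.+1) (x y : int) h : i != j ->
  deg (fun h => if h == i then x else if h == j then y else 0) h =
  alpha h i * x%:~R + alpha h j * y%:~R.
Proof.
move=> ij; rewrite /deg (bigD1 i)//= eqxx (bigD1 j)/=; last by rewrite eq_sym.
rewrite eqxx eq_sym (negPf ij) big1 ?addr0// => h' /andP[/negPf -> /negPf ->].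
by rewrite mulr0.
Qed.

Let degC (i : 'I_n.+1) := \sum_h alpha h i.

(** Total degree of the character with value q_j on the i-th ray, -q_i on the j-th and 0
    elsewhere. *)
Let deg_proportional i j : i != j -> degC i * (q j)%:R = degC j * (q i)%:R.
Proof.
move=> ij.
have r : weight_relation
    (fun h => if h == i then (q j)%:Z else if h == j then - (q i)%:Z else 0).
  by apply: weight_relation_pair => //; rewrite mulrN [X in _ - X]mulrC subrr.
have := deg_sum0 r; under eq_bigr do rewrite deg_pair//.
rewrite big_split/= -!mulr_suml rmorphN /= mulrN => /eqP.
by rewrite subr_eq0 => /eqP.
Qed.

(** If two divisors have contact orders in the ratio of their weights at every marking, a character
    supported on their two rays has all degrees zero. Otherwise every marking meets at most one
    divisor, and Bezout provides the character. *)
Lemma exists_pth_power_character (p : nat) (j : 'I_n.+1) : prime p -> (p %| q j)%N ->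
  exists a : 'I_n.+1 -> int, [/\ weight_relation a, exists i, ~~ (p%:Z %| a i)%Z &
    forall h, exists d : int, deg a h = (d * p%:Z)%:~R].
Proof.
move=> pp pq.
have [[i [i' [ii' ee]]]|nee] := pselect (exists i i', i != i' /\
    forall h, alpha h i * (q i')%:R = alpha h i' * (q i)%:R).
  pose g := gcdn (q i) (q i').
  have g0 : (0 < g)%N by rewrite gcdn_gt0 q_gt0.
  have qi : q i = (q i %/ g * g)%N by rewrite divnK// dvdn_gcdl.
  have qi' : q i' = (q i' %/ g * g)%N by rewrite divnK// dvdn_gcdr.
  exists (fun h => if h == i then (q i' %/ g)%:Z
                   else if h == i' then - (q i %/ g)%:Z else 0).
  split.
  - apply: weight_relation_pair => //; rewrite [in X in X * _]qi [in X in _ + X * _]qi'.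
    by rewrite !PoszM; ring.
  (* After division by the gcd the two values are coprime, so p cannot divide both. *)
  - have [pi'|] := boolP (p %| q i' %/ g)%N; last by exists i; rewrite eqxx.
    exists i'; rewrite eq_sym (negPf ii') eqxx dvdzE abszN; apply/negP => pi.
    have : (p %| gcdn (q i %/ g) (q i' %/ g))%N by rewrite dvdn_gcd pi.
    have -> : gcdn (q i %/ g) (q i' %/ g) = 1%N.
      by apply/eqP; rewrite -(eqn_pmul2r g0) muln_gcdl -qi -qi' mul1n.
    by rewrite dvdn1 => /eqP p1; rewrite p1 in pp.
  move=> h; exists 0; rewrite mul0r deg_pair// rmorphN /= mulrN.
  have gn : g%:R != 0 :> rat by rewrite pnatr_eq0 -lt0n.
  apply/eqP; rewrite subr_eq0; apply/eqP/(mulIf gn).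
  by rewrite -!mulrA -!natrM -qi' -qi ee.
(* If one total vanishes, all do, so every contact order is zero and any two indices fall under the
   excluded case; n >= 1 provides two. *)
have degC_neq0 i : degC i != 0.
  apply/eqP => C0.
  have C0' i' : degC i' = 0.
    have [->//|ii'] := eqVneq i' i; apply: (mulIf (q_neq0 i)).
    by rewrite deg_proportional// C0 !mul0r.
  have a0 h i' : alpha h i' = 0.
    have /eqP := C0' i'; rewrite psumr_eq0// => /allP/(_ h).
    by rewrite mem_index_enum => /(_ isT)/eqP.
  apply: nee; have n1 : (1 < n.+1)%N by have [] := wf.
  exists ord0, (Ordinal n1); split=> // h; by rewrite !a0 !mul0r.
(* If h met two divisors, uniqueness would concentrate the whole contact of both at h, and
   [deg_proportional] would give the excluded case. *)
have only h i i' : i != i' -> 0 < alpha h i -> alpha h i' = 0.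
  move=> ii' hi; apply/eqP; have := alpha_ge0 h i'; rewrite le0r => /orP[//|hi'].
  case: nee; exists i, i'; split=> // h'.
  have Ch i0 : 0 < alpha h i0 -> degC i0 = alpha h i0.
    move=> hi0; rewrite /degC (bigD1 h)//= big1 ?addr0// => h0 h0h.
    apply/eqP; have := alpha_ge0 h0 i0; rewrite le0r => /orP[//|h0i0].
    by case/eqP: h0h; apply: alpha_uniq h0i0 hi0.
  have [->|h'h] := eqVneq h' h; first by rewrite -(Ch i)// -(Ch i')// deg_proportional.
  have z i0 : 0 < alpha h i0 -> alpha h' i0 = 0.
    move=> hi0; apply/eqP; have := alpha_ge0 h' i0; rewrite le0r => /orP[//|h0i0].
    by case/eqP: h'h; apply: alpha_uniq h0i0 hi0.
  by rewrite !z// !mul0r.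
(* A character with value 1 on the i-th ray has degree [alpha h i] at h, as h meets no other
   divisor. *)
have alpha_int h i : alpha h i \is a Num.int.
  have := alpha_ge0 h i; rewrite le0r => /orP[/eqP ->//|hi].
  have [b bE] := bezout_weights i (- ((q i)%:Z * 1)).
  have := deg_int (weight_relation_at bE) h.
  rewrite /deg (bigD1 i)//= eqxx mulr1 big1 ?addr0//.
  by move=> i' i'i; rewrite (only h i i') ?mul0r// eq_sym.
have /dvdnP[r rE] := pq.
(* With q_j = r p, the choice sum_(i <> j) q_i b_i = -r makes a_j = 1, a_i = p b_i a relation. *)
have [b bE] := bezout_weights j (- r%:Z).
pose a i : int := if i == j then 1 else b i * p%:Z.
have ra : weight_relation a.
  apply: weight_relation_at; rewrite mulr1 rE PoszM -mulNr -bE mulr_suml.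
  by apply: eq_bigr => i _; rewrite mulrA.
exists a; split=> //.
  by exists j; rewrite /a eqxx dvdzE /= dvdn1; apply: contraTneq pp => ->.
pose good h := exists d : int, deg a h = (d * p%:Z)%:~R.
have good0 h : alpha h j = 0 -> good h.
  move=> hj; exists (\sum_(i | i != j) Num.floor (alpha h i) * b i).
  rewrite /deg (bigD1 j)//= hj mul0r add0r mulr_suml rmorph_sum /=.
  apply: eq_bigr => i /negPf ij; rewrite /a ij -mulrA [RHS]rmorphM /=.
  by rewrite floorK.
move=> h; have [hj|hj] := eqVneq (alpha h j) 0; first exact: good0.
have hj0 : 0 < alpha h j by rewrite lt0r hj alpha_ge0.
have other h' : h' != h -> good h'.
  move=> h'h; apply: good0; apply/eqP; have := alpha_ge0 h' j; rewrite le0r => /orP[//|h'j].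
  by case/eqP: h'h; apply: alpha_uniq h'j hj0.
have [d dE] : exists d : int, \sum_(h' | h' != h) deg a h' = (d * p%:Z)%:~R.
  apply: (big_ind (fun y => exists d : int, y = (d * p%:Z)%:~R)) => //.
    by exists 0; rewrite mul0r.
  by move=> _ _ [d ->] [d' ->]; exists (d + d'); rewrite mulrDl rmorphD.
(* At the unique marking on the j-th divisor the degree is minus the sum of all others, each
   divisible by p. *)
exists (- d); rewrite mulNr rmorphN /= -dE; apply/eqP.
by rewrite -addr_eq0; have /eqP := deg_sum0 ra; rewrite (bigD1 h).
Qed.

End ContactOrders.

(** As e_j = v_j / q_j with v_j a standard basis vector, <m, e_j> = a_j requires the coordinate a_j
    q_j. The value on the last ray is then dictated by the relation. *)
Definition relation_character (a : 'I_n.+1 -> int) : 'rV[rat]_n :=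
  \row_j ((a (lift ord_max j))%:~R * (q (lift ord_max j))%:R).

Lemma pairing_sum (m : 'rV[rat]_n) (I : finType) (P : pred I) (c : I -> rat)
    (v : I -> 'rV[rat]_n) :
  pairing m (\sum_(i | P i) c i *: v i) = \sum_(i | P i) c i * pairing m (v i).
Proof.
rewrite /pairing; under eq_bigr do rewrite summxE mulr_sumr.
rewrite exchange_big; apply: eq_bigr => i _; rewrite mulr_sumr.
by apply: eq_bigr => j _; rewrite mxE mulrCA.
Qed.

Lemma pairing_relation_character a i : weight_relation a ->
  pairing (relation_character a) (weighted_ray q i) = (a i)%:~R.
Proof.
move=> ra; have pr : pairing (relation_character a) (weighted_ray q i) =
   (q i)%:R^-1 * pairing (relation_character a) (pn_ray i).
  rewrite /pairing mulr_sumr; apply: eq_bigr => j _.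
  by rewrite [weighted_ray _ _ _ _]mxE mulrCA.
rewrite pr /pn_ray /pairing; case: unliftP => [i' ->|->].
  rewrite (bigD1 i')//= big1 ?addr0 => [|j /negPf ji].
    by rewrite !mxE !eqxx mulr1 mulrC mulfK.
  by rewrite !mxE eqxx /= ji mulr0.
apply: (mulfI (q_neq0 ord_max)); rewrite mulVKf//.
under eq_bigr do rewrite !mxE mulrN1.
have /(congr1 (fun x : int => x%:~R : rat)) := ra.
rewrite rmorph_sum (bigD1_ord ord_max)//= => /eqP.
rewrite rmorphM /= addr_eq0 => /eqP ->; rewrite -sumrN.
by apply: eq_bigr => j _; rewrite rmorphM /= mulrC.
Qed.

Lemma relation_characterP a : weight_relation a ->
  characters (weighted_fan q) (relation_character a).
Proof.
move=> ra v [b]; under eq_bigr do rewrite -tnth_nth tnth_mktuple -scaler_int.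
move=> ->; rewrite pairing_sum; apply: rpred_sum => i _.
by rewrite pairing_relation_character//; apply: rpredM; apply: rpred_int.
Qed.

End Weights.

(** * Toric varieties *)

Section ToricVarieties.
Variables (k : closedFieldType) (n r : nat) (S : fan n r).
Hypothesis cone0 : finset.set0 \in cones S.

Let X : kspace k := toric_variety S k.

Let chart_fun (s : {set 'I_r}) : set (toric_point S k -> k) :=
  [set f | exists l (c : 'I_l -> k) (m : 'I_l -> 'rV[rat]_n),
     (forall i, dual_semigroup S s (m i)) /\
     f = fun x => \sum_(i < l) c i * character_fun (m i) x].

Let chart (s : {set 'I_r}) : set (toric_point S k) * set (toric_point S k -> k) :=
  ([set x | orbit_cone x \subset s], chart_fun s).

Let atlas := [set C : set (toric_point S k) * set (toric_point S k -> k) |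
  exists s, [/\ s \in cones S, C.1 = [set x | orbit_cone x \subset s] & C.2 = chart_fun s]].

Let atlas_chart s : s \in cones S -> atlas (chart s).
Proof. by exists s. Qed.

Lemma dual_semigroupS (s s' : {set 'I_r}) : s' \subset s ->
  dual_semigroup S s `<=` dual_semigroup S s'.
Proof.
move=> ss m [mM ms]; split=> // v [a [a0 vE]]; apply: ms.
exists (fun i => if i \in s' then a i else 0); split=> [i|]; first by case: ifP.
rewrite vE [RHS](finset.big_setID s') /= (finset.setIidPr ss) [X in _ + X]big1 ?addr0 => [|i].
  by apply: eq_bigr => i ->.
by rewrite inE => /andP[/negPf ->]; rewrite scale0r.
Qed.

Lemma dual_semigroup0 (s : {set 'I_r}) : dual_semigroup S s 0.
Proof.
have p0 v : pairing (0 : 'rV[rat]_n) v = 0.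
  by rewrite /pairing big1// => i _; rewrite mxE mul0r.
by split=> v _; rewrite p0.
Qed.

Lemma dual_semigroupD (s : {set 'I_r}) m m' :
  dual_semigroup S s m -> dual_semigroup S s m' -> dual_semigroup S s (m + m').
Proof.
have pD v : pairing (m + m') v = pairing m v + pairing m' v.
  by rewrite /pairing -big_split; apply: eq_bigr => i _; rewrite mxE mulrDl.
move=> [mM ms] [m'M m's]; split=> v vP; rewrite pD.
  by apply: rpredD; [exact: mM|exact: m'M].
by rewrite addr_ge0 ?ms ?m's.
Qed.

Lemma dual_semigroup_torus m : characters S m -> dual_semigroup S finset.set0 m.
Proof.
move=> mM; split=> // v [a [_ ->]]; rewrite big_set0 /pairing big1// => i _.
by rewrite mxE mulr0.
Qed.

Let chart_funM (s : {set 'I_r}) f g : chart_fun s f -> chart_fun s g ->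
  exists2 h, chart_fun s h &
    forall x : toric_point S k, orbit_cone x \subset s -> h x = f x * g x.
Proof.
move=> [l [c [m [mP ->]]]] [l' [c' [m' [m'P ->]]]].
pose J := ('I_l * 'I_l')%type.
exists (fun x => \sum_(i < #|{: J}|) (c (enum_val i).1 * c' (enum_val i).2) *
    character_fun (m (enum_val i).1 + m' (enum_val i).2) x).
  exists #|{: J}|, (fun i => c (enum_val i).1 * c' (enum_val i).2).
  exists (fun i => m (enum_val i).1 + m' (enum_val i).2).
  by split=> // i; exact: dual_semigroupD.
move=> x xs; rewrite big_distrlr pair_big /=.
rewrite [RHS](reindex_onto (@enum_val _ {: J}) enum_rank) /=; last first.
  by move=> i _; rewrite enum_rankK.
apply: eq_big => [i|i _]; first by rewrite enum_valK eqxx.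
rewrite mulrACA /character_fun chiD//; exact: dual_semigroupS xs _ _.
Qed.

Let chart_ringP (s : {set 'I_r}) : chart_ring (chart s).
Proof.
split=> [c|_ _ [l [c [m [mP ->]]]] [l' [c' [m' [m'P ->]]]]|]; last exact: chart_funM.
  exists 1%N, (fun=> c), (fun=> 0); split=> [_|]; first exact: dual_semigroup0.
  by apply/funext => x; rewrite big_ord1 /character_fun chi0 mulr1.
exists (fun x => \sum_(i < l) c i * character_fun (m i) x +
                 \sum_(i < l') c' i * character_fun (m' i) x) => //.
pose F T (u : 'I_l -> T) (u' : 'I_l' -> T) (i : 'I_(l + l')) :=
  match fintype.split i with inl i => u i | inr i => u' i end.
exists (l + l')%N, (F _ c c'), (F _ m m'); split=> [i|].
  by rewrite /F; case: (fintype.split i).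
apply/funext => x; rewrite big_split_ord /F /=; congr (_ + _).
  by apply: eq_bigr => i _; rewrite (unsplitK (inl _ i)).
by apply: eq_bigr => i _; rewrite (unsplitK (inr _ i)).
Qed.

(** The chart of the orbit cone of x is the smallest one containing x, so it refines any two
    others. *)
Lemma toric_regular_ring : regular_ring X.
Proof.
apply: (@glued_regular_ring _ _ atlas) => [x|x C C'].
  by exists (chart (orbit_cone x)); [apply: atlas_chart; exact: orbit_coneP|exact: subxx].
move=> [s [sS C1 C2]] [s' [s'S C1' C2']]; rewrite C1 C1' C2 C2' => xs xs'.
exists (chart (orbit_cone (x : toric_point S k))); split.
- by apply: atlas_chart; exact: orbit_coneP.
- exact: subxx.
- exact: chart_ringP.
- apply: refines_sub => _ [l [c [m [mP ->]]]]; exists l, c, m; split=> // i.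
  exact: dual_semigroupS xs _ (mP i).
apply: refines_sub => _ [l [c [m [mP ->]]]]; exists l, c, m; split=> // i.
exact: dual_semigroupS xs' _ (mP i).
Qed.

Definition torus : set X := [set x : toric_point S k | orbit_cone x = finset.set0].

Lemma not_boundary (x : X) : ~ toric_boundary x -> torus x.
Proof.
move=> nb; apply/eqP; apply: contraT => /set0Pn[i ix].
by case: nb; exists i.
Qed.

Lemma open_torus : open torus.
Proof.
apply: basic_open; exists (chart finset.set0), (fun=> 1).
  by split; [exact: atlas_chart|have [+ _ _] := chart_ringP finset.set0; exact].
apply/seteqP; split=> x /=; last by rewrite finset.subset0 => -[/eqP].
by rewrite /torus /= => ->; rewrite subxx oner_eq0.
Qed.

Lemma character_regular m : characters S m ->
  regular_on torus (character_fun m : X -> k).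
Proof.
move=> mM x Tx; exists (chart finset.set0), (character_fun m), (fun=> 1); split.
- exact: atlas_chart.
- exists 1%N, (fun=> 1), (fun=> m); split=> [_|]; first exact: dual_semigroup_torus.
  by apply/funext => y; rewrite big_ord1 mul1r.
- by have [+ _ _] := chart_ringP finset.set0; exact.
- by rewrite oner_eq0; split=> //=; rewrite [orbit_cone _]Tx.
by near=> y; rewrite divr1.
Unshelve. all: by end_near. Qed.

Lemma charactersN m : characters S m -> characters S (- m).
Proof.
have pN v : pairing (- m) v = - pairing m v.
  by rewrite /pairing -sumrN; apply: eq_bigr => i _; rewrite mxE mulNr.
by move=> mM v vS; rewrite pN rpredN; exact: mM.
Qed.

Lemma character_inv m (x : X) : characters S m -> torus x ->
  character_fun m x * character_fun (- m) x = 1.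
Proof.
move=> mM Tx; rewrite /character_fun -chiD ?subrr ?chi0// [orbit_cone _]Tx.
  exact: dual_semigroup_torus.
by apply: dual_semigroup_torus; exact: charactersN.
Qed.

Lemma character_neq0 m (x : X) : characters S m -> torus x -> character_fun m x != 0.
Proof.
move=> mM Tx; apply/eqP => m0; have := character_inv mM Tx.
by rewrite m0 mul0r => /esym/eqP; rewrite oner_eq0.
Qed.

Section Translate.
Variables (u : 'rV[rat]_n) (s : k) (x : toric_point S k).
Hypotheses (uS : lattice S u) (s0 : s != 0) (Tx : torus x).

(** The point x moved by the one-parameter subgroup u at time s. [Num.floor] only reads an integral
    rational as an integer, and the default 0 is the one [chi_default] demands. *)
Let w m := if `[< characters S m >] then s ^ Num.floor (pairing m u) * chi x m else 0.

Let wE m : characters S m -> w m = s ^ Num.floor (pairing m u) * chi x m.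
Proof. by move=> mM; rewrite /w asboolT. Qed.

Let w0 : w 0 = 1.
Proof.
rewrite wE ?chi0; last by have [] := dual_semigroup0 finset.set0.
rewrite /pairing big1 ?floor0 ?mulr1 ?expr0z// => i _.
by rewrite mxE mul0r.
Qed.

Let wD m m' : dual_semigroup S finset.set0 m -> dual_semigroup S finset.set0 m' ->
  w (m + m') = w m * w m'.
Proof.
move=> mP m'P; have [mM _] := mP; have [m'M _] := m'P.
have [mmM _] := dual_semigroupD mP m'P.
rewrite !wE// chiD ?[orbit_cone _]Tx// mulrACA -expfzDr//; congr (s ^ _ * _).
rewrite -floorDzr; last exact: mM.
congr Num.floor; rewrite /pairing -big_split; apply: eq_bigr => i _.
by rewrite mxE mulrDl.
Qed.

Let w_minimal m : dual_semigroup S finset.set0 m -> ~ orthogonal S finset.set0 m -> w m = 0.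
Proof.
move=> _ []; move=> v [a [_ ->]]; rewrite big_set0 /pairing big1// => i _.
by rewrite mxE mulr0.
Qed.

Let w_default m : ~ dual_semigroup S finset.set0 m -> w m = 0.
Proof. by move=> nm; rewrite /w asboolF// => /dual_semigroup_torus. Qed.

Definition translate : toric_point S k := ToricPoint cone0 w0 wD w_minimal w_default.

Lemma translateE m : characters S m ->
  character_fun m translate = s ^ Num.floor (pairing m u) * character_fun m x.
Proof. exact: wE. Qed.

End Translate.

(** The value at s = 0 is a placeholder in the torus. At s = 1 the curve is set to x itself, which
    avoids an equality between [toric_point] records. *)
Lemma torus_curve (u : 'rV[rat]_n) (x : X) : lattice S u -> torus x ->
  exists gamma : k -> X, [/\ gamma 1 = x, forall s, torus (gamma s) &
    forall m s, characters S m -> s != 0 ->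
      character_fun m (gamma s) = s ^ Num.floor (pairing m u) * character_fun m x].
Proof.
move=> uS Tx; pose pt s := if pselect (s != 0) is left s0 then translate uS s0 Tx else x.
exists (fun s => if s == 1 then x else pt s); rewrite eqxx; split=> // [s|m s mM s0].
  by case: eqP => // _; rewrite /pt; case: pselect.
case: eqVneq => [->|_]; first by rewrite exp1rz mul1r.
by rewrite /pt; case: pselect => // s0'; rewrite translateE.
Qed.

Section TorusCurveGerm.
Variables (u : 'rV[rat]_n) (x : X) (gamma : k -> X).
Hypotheses (gamma1 : gamma 1 = x) (gammaT : forall s, torus (gamma s))
  (gammaE : forall m s, characters S m -> s != 0 ->
      character_fun m (gamma s) = s ^ Num.floor (pairing m u) * character_fun m x).

Lemma expz_germ (d : int) : germ_frac 1 (fun s : k => s ^ d).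
Proof.
apply: germ_frac_ext (germ_frac_expz d (germ_frac_sub 1 0) _); rewrite ?subr0 ?oner_eq0//.
by near=> s; rewrite subr0.
Unshelve. all: by end_near. Qed.

Lemma torus_chart_germ C : atlas C -> C.1 (gamma 1) ->
  (\forall s \near cofin k, C.1 (gamma s)) /\
  forall f, C.2 f -> germ_frac 1 (f \o gamma).
Proof.
move=> [s [sS -> ->]] _; split.
  by near=> t; rewrite /= [orbit_cone _]gammaT finset.sub0set.
move=> _ [l [c [m [mP ->]]]]; apply: germ_frac_sum => i.
apply: germ_frac_mul; first exact: germ_frac_cst.
have [mM _] := mP i.
apply: germ_frac_ext (germ_frac_mul (expz_germ _) (germ_frac_cst 1 (character_fun (m i) x))).
  by rewrite gammaE// oner_eq0.
have n0 := cofin_neq (0 : k); near=> t; apply: gammaE => //.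
by near: t.
Unshelve. all: by end_near. Qed.

Lemma torus_curve_near (A : set X) : nbhs (gamma 1) A ->
  \forall s \near cofin k, A (gamma s).
Proof. exact: (@curve_near _ _ atlas gamma 1 torus_chart_germ). Qed.

Lemma torus_curve_germ (phi : X -> k) : regular_at (gamma 1) phi ->
  germ_frac 1 (phi \o gamma).
Proof. exact: (@curve_germ _ _ atlas gamma 1 torus_chart_germ). Qed.

End TorusCurveGerm.

Lemma torus_nonempty : torus !=set0.
Proof.
pose w m : k := if `[< characters S m >] then 1 else 0.
have wE m : dual_semigroup S finset.set0 m -> w m = 1 by move=> [mM _]; rewrite /w asboolT.
have w0 : w 0 = 1 by apply: wE; exact: dual_semigroup0.
have wD m m' : dual_semigroup S finset.set0 m -> dual_semigroup S finset.set0 m' ->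
    w (m + m') = w m * w m'.
  by move=> mP m'P; rewrite !wE ?mulr1//; exact: dual_semigroupD.
have wm m : dual_semigroup S finset.set0 m -> ~ orthogonal S finset.set0 m -> w m = 0.
  move=> _ []; move=> v [a [_ ->]]; rewrite big_set0 /pairing big1// => i _.
  by rewrite mxE mulr0.
have wd m : ~ dual_semigroup S finset.set0 m -> w m = 0.
  by move=> nm; rewrite /w asboolF// => /dual_semigroup_torus.
by exists (ToricPoint cone0 w0 wD wm wd).
Qed.

End ToricVarieties.

(** * Curves in a product and p-th powers along them *)

(** Makes [curve_near] and [curve_germ] available for the curve s |-> (gamma s, y), along which
    functions of the second factor are constants. *)
Lemma prod_chart_germ (k : closedFieldType) (X Y : kspace k) (gamma : k -> X)
    (a : k) (y : Y) :
  (forall A : set X, nbhs (gamma a) A -> \forall s \near cofin k, A (gamma s)) ->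
  (forall phi : X -> k, regular_at (gamma a) phi -> germ_frac a (phi \o gamma)) ->
  forall C : set (X * Y) * set (X * Y -> k),
    (exists (U : set X) (V : set Y), [/\ open U, open V, C.1 = U `*` V &
      C.2 = [set h | exists l (a : 'I_l -> X -> k) (b : 'I_l -> Y -> k),
        (forall i, regular_on U (a i) /\ regular_on V (b i)) /\
        h = fun z => \sum_(i < l) a i z.1 * b i z.2]]) ->
    C.1 (gamma a, y) -> (\forall s \near cofin k, C.1 (gamma s, y)) /\
    forall f, C.2 f -> germ_frac a (fun s => f (gamma s, y)).
Proof.
move=> nX gX C [U [V [oU oV -> ->]]] [Ua Vy]; split.
  have nU := nX U (open_nbhs_nbhs (conj oU Ua)).
  by near=> s; split=> //=; near: s.
move=> _ [l [f [g [r ->]]]]; apply: germ_frac_sum => i.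
apply: germ_frac_mul; last exact: germ_frac_cst.
by apply: gX; exact: (r i).1.
Unshelve. all: by end_near. Qed.

(** Comparing degrees: p deg A = p deg B + e. *)
Lemma poly_pth_power_size (k : fieldType) (p e : nat) (c : k) (A B : {poly k}) :
  c != 0 -> B != 0 -> A ^+ p = c *: (B ^+ p * 'X^e) -> (p %| e)%N.
Proof.
move=> c0 B0 /(congr1 (fun R : {poly k} => (size R).-1)).
rewrite size_exp size_scale// size_Mmonic ?monicXn ?expf_neq0// size_polyXn addnS /=.
rewrite -(prednK (n := size (B ^+ p))) ?size_poly_gt0 ?expf_neq0// addSn /= size_exp.
by move=> e1; rewrite -(dvdn_addr _ (dvdn_mull (size B).-1 (dvdnn p))) -e1 dvdn_mull.
Qed.

Lemma pth_power_order (k : closedFieldType) (p : nat) (h : k -> k) (c : k) (d : int) :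
  prime p -> germ_frac 1 h -> c != 0 ->
  (\forall s \near cofin k, h s ^+ p = s ^ d * c) -> (p%:Z %| d)%Z.
Proof.
move=> pp [P [Q [/horner_neq0 Q0 _ hE]]] c0 hp.
have [n0 nQ] := (cofin_neq (0 : k), cofin_horner Q0).
have PQ : \forall s \near cofin k, P.[s] ^+ p = s ^ d * (c * Q.[s] ^+ p).
  near=> s; have Qs : Q.[s] != 0 by near: s.
  rewrite mulrA; have <- : h s ^+ p = s ^ d * c by near: s.
  have -> : h s = P.[s] / Q.[s] by near: s.
  by rewrite -exprMn divfK.
have P0 : P != 0.
  apply: contraTneq isT => P0; exfalso.
  have [T TP] : \forall s \near cofin k, s ^ d * (c * Q.[s] ^+ p) = 0 /\ s != 0 /\ Q.[s] != 0.
    near=> s; have <- : P.[s] ^+ p = s ^ d * (c * Q.[s] ^+ p) by near: s.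
    split; first by rewrite P0 horner0 expr0n gtn_eqF// prime_gt0.
    by split; near: s.
  have /closed_nonrootP[s] := monic_neq0 (monic_prod_XsubC T xpredT id).
  rewrite root_prod_XsubC => /TP[/eqP + [s0 Qs]].
  by apply/negP; rewrite !mulf_neq0 ?expf_neq0 ?expfz_neq0.
(* The sign of d decides on which side of P^p = c s^d Q^p the power of X is placed. *)
case: d hp PQ => e hp PQ.
  apply: (@poly_pth_power_size _ p e c P Q c0 Q0); apply: cofin_poly_eq.
  near=> s; rewrite hornerZ hornerM !horner_exp hornerX.
  have -> : P.[s] ^+ p = s ^ e * (c * Q.[s] ^+ p) by near: s.
  by rewrite [LHS]mulrC -mulrA.
rewrite dvdzE /=; apply: (@poly_pth_power_size _ p e.+1 c^-1 Q P) => //.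
  by rewrite invr_eq0.
apply: cofin_poly_eq; near=> s; have s0 : s != 0 by near: s.
rewrite hornerZ hornerM !horner_exp hornerX.
have -> : P.[s] ^+ p = s ^ Negz e * (c * Q.[s] ^+ p) by near: s.
have -> : s ^ Negz e = (s ^+ e.+1)^-1 by [].
by rewrite mulrAC mulVf ?expf_neq0// mul1r mulKf.
Unshelve. all: by end_near. Qed.

(* Restricting to the curve s |-> (s . x, y), with s acting through the one-
   parameter subgroup u, turns a p-th root of the character into one of s^d. *)
Lemma character_no_pth_root (k : closedFieldType) n r (S : fan n r) (p : nat)
    (m u : 'rV[rat]_n) (d : int)
    (theta : prod_space (toric_variety S k) (toric_variety S k) -> k) :
  finset.set0 \in cones S -> prime p -> characters S m -> lattice S u ->
  pairing m u = d%:~R -> rational_fun theta ->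
  generically_equal (fun z => theta z ^+ p)
    (fun z => character_fun m z.1 * character_fun (- m) z.2) ->
  (p%:Z %| d)%Z.
Proof.
move=> S0 pp mM uS mu [U [oU dU rU]] [V [oV dV eV]].
set X := toric_variety S k in theta U V oU dU rU oV dV eV.
pose T : set X := @torus k n r S.
have rX : regular_ring X by exact: toric_regular_ring.
have oT : open T by exact: open_torus.
have [x0 Tx0] : T !=set0 by exact: torus_nonempty.
have [||[x y] [[Tx Ty] [Uxy Vxy]]] := denseI oU dU dV (O := T `*` T).
- by exists (x0, x0).
- exact: open_prod.
have [gamma [g1 gT gE]] := torus_curve S0 uS Tx.
have gnear := torus_curve_near gT gE.
have ggerm := torus_curve_germ gT gE.
have chartP := @prod_chart_germ k X X gamma 1 y gnear ggerm.
have Uxy' : U (gamma 1, y) by rewrite g1.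
have Vxy' : V (gamma 1, y) by rewrite g1.
have rth := curve_germ chartP (rU _ Uxy').
have nV := curve_near chartP (open_nbhs_nbhs (conj oV Vxy')).
apply: (pth_power_order pp rth (c := character_fun m x * character_fun (- m) y)).
  by rewrite mulf_neq0// character_neq0//; exact: charactersN.
have n0 := cofin_neq (0 : k).
near=> s; rewrite /= [LHS]eV /=; last by near: s.
by rewrite gE//; [rewrite mu intrKfloor mulrA|near: s].
Unshelve. all: by end_near. Qed.

(** * Families of log maps *)

Section Generic.
Variables (k : fieldType) (X : kspace k).

(** As a filter, genericity lets finitely many generic conditions be combined by [near] into one
    dense open set. *)
Definition generic : set_system X :=
  [set A | exists U : set X, [/\ open U, dense U & U `<=` A]].

Global Instance generic_filter : Filter generic.
Proof.
split.
- by exists setT; split=> //; [exact: openT|move=> O O0 _; rewrite setIT].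
- move=> A B [U [oU dU UA]] [V [oV dV VB]]; exists (U `&` V).
  by split; [exact: openI|exact: denseI|move=> x [/UA ? /VB]].
- by move=> A B AB [U [oU dU UA]]; exists U; split=> // x /UA /AB.
Qed.

Variables (K : fieldType) (cls : (X -> k) -> K).
Hypotheses (rX : regular_ring X) (ffX : function_field cls).

Lemma open_generic (U : set X) : open U -> U !=set0 -> generic U.
Proof. by move=> oU U0; exists U; split=> //; exact: (function_field_dense rX ffX). Qed.

Lemma regular_generic_neq0 (U : set X) (phi : X -> k) : open U ->
  regular_on U phi -> (exists2 x, U x & phi x != 0) ->
  generic [set x | phi x != 0].
Proof.
move=> oU rU [x0 Ux0 nz0].
have oN : open (U `&` [set x | phi x != 0]).
  rewrite openE => x [Ux nz]; rewrite /interior.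
  by apply: filterI; [exact: open_nbhs_nbhs|apply: (regular_neq0 rX) => //; exact: rU].
by apply: filterS (open_generic oN _) => [x []//|]; exists x0.
Qed.

Lemma function_field_pchar (p : nat) : p \in [pchar k] -> p \in [pchar K].
Proof.
move=> pk; rewrite inE (pcharf_prime pk) /= -(cls_nat rX ffX) pcharf0//.
by rewrite (cls0 rX ffX).
Qed.

End Generic.

Arguments generic {k} X _.

Section LogMap.
Variables (k : closedFieldType) (n r : nat) (S : fan n r).
Hypothesis S0 : finset.set0 \in cones S.
Variables (l : nat) (f : proj_line k -> toric_variety S k) (p : 'I_l -> proj_line k)
  (c : 'I_l -> 'rV[rat]_n).
Hypothesis flog : stable_log_map f p c.

Lemma log_map_torus x : (forall j, x <> p j) -> torus (f x).
Proof.
move=> xp; apply: not_boundary => /(let: And5 _ _ _ (conj _ h) _ := flog in h).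
by move=> [j xj]; exact: (xp j).
Qed.

(** Off the markings the map lands in the torus, where characters are regular and invertible, so
    [proj_line_function] applies. *)
Lemma log_map_character (m : 'rV[rat]_n) (d : 'I_l -> int) : characters S m ->
  (forall j, pairing m (c j) = (d j)%:~R) ->
  \sum_j d j = 0 /\ exists2 b, b != 0 &
    forall s, (forall j, Some s <> p j) -> character_fun m (f (Some s)) =
      b * \prod_(j | isSome (p j : option k)) (s - affine_coord (p j)) ^ d j.
Proof.
move=> mM dE; have [[_ fr] pI _ _ ford] := flog.
apply: (proj_line_function (g := character_fun m \o f) pI) => [j|x xp].
  have [_ /(_ m mM)[e eE]] := ford j.
  by rewrite dE in eE; rewrite (intr_inj eE).
have Tx := log_map_torus xp; split; last exact: character_neq0.
by apply: fr; exact: character_regular.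
Qed.

End LogMap.

Section Family.
Variables (k : closedFieldType) (n r : nat) (S : fan n r).
Hypothesis S0 : finset.set0 \in cones S.
Let X := toric_variety S k.
Let P1 := proj_line k.
Variables (W : kspace k) (l : nat) (ev : prod_space W P1 -> X)
  (mark : 'I_l -> W -> prod_space W P1) (c : 'I_l -> 'rV[rat]_n).
Hypothesis rW : regular_ring W.
Hypothesis fam : log_map_family ev mark c.
Let Y := prod_space (prod_space W P1) P1.
Variables (K : fieldType) (cls : (Y -> k) -> K).
Hypothesis ffY : function_field cls.
Variables (p : nat) (m : 'rV[rat]_n) (d : 'I_l -> int).
Hypotheses (mM : characters S m) (md : forall j, pairing m (c j) = (d j * p%:Z)%:~R).

Let rP1 : regular_ring P1. Proof. exact: proj_line_regular_ring. Qed.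
Let rWP : regular_ring (prod_space W P1). Proof. exact: prod_regular_ring. Qed.
Let rY : regular_ring Y. Proof. exact: prod_regular_ring. Qed.

Let finite_part : set P1 := [set x : option k | x != None].
Let section_part j : set W := [set w | ((mark j w).2 : option k) != None].
Let t1 (z : Y) : k := affine_coord z.1.2.
Let t2 (z : Y) : k := affine_coord z.2.
Let pos j (z : Y) : k := affine_coord (mark j z.1.1).2.

Let open_finite : open finite_part. Proof. exact: open_affine_part. Qed.

Let open_section j : open (section_part j).
Proof.
have [_ /(_ j)[[mc _] _] _] := fam.
have := open_comp (f := mark j) (D := snd @^-1` finite_part) (in1W (mc)).
by apply; exact: open_snd.
Qed.

Let open_t1 : open [set z : Y | finite_part z.1.2].
Proof.
apply: (@open_fst _ (prod_space W P1) P1 rWP rP1 (snd @^-1` finite_part)).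
exact: open_snd.
Qed.

Let open_t2 : open [set z : Y | finite_part z.2].
Proof. by apply: (@open_snd _ (prod_space W P1) P1 rWP rP1 finite_part). Qed.

Let open_pos j : open [set z : Y | section_part j z.1.1].
Proof.
apply: (@open_fst _ (prod_space W P1) P1 rWP rP1 (fst @^-1` section_part j)).
exact: open_fst.
Qed.

Let regular_t1 : regular_on [set z : Y | finite_part z.1.2] t1.
Proof.
apply: (@regular_on_fst _ (prod_space W P1) P1 rWP rP1 (snd @^-1` finite_part)
  (@affine_coord k \o snd)).
  exact: open_snd.
by apply: regular_on_snd => //; exact: affine_coord_regular.
Qed.

Let regular_t2 : regular_on [set z : Y | finite_part z.2] t2.
Proof.
apply: (@regular_on_snd _ (prod_space W P1) P1 rWP rP1 finite_part) => //.
exact: affine_coord_regular.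
Qed.

Let regular_pos j : regular_on [set z : Y | section_part j z.1.1] (pos j).
Proof.
apply: (@regular_on_fst _ (prod_space W P1) P1 rWP rP1 (fst @^-1` section_part j)
  ((fun w => affine_coord (mark j w).2) \o fst)); first exact: open_fst.
apply: regular_on_fst => // w jw.
have [_ /(_ j)[[_ mr] _] _] := fam; apply: (mr w (@affine_coord k \o snd)).
by apply: (@regular_on_snd _ W P1 rW rP1 finite_part) => //; exact: affine_coord_regular.
Qed.

(** A marking at infinity for every w contributes no linear factor; any other one is finite over a
    nonempty open subset of W, hence generically on Y. *)
Let finite_section j := `[< exists w, section_part j w >].

Let rational_of (U : set Y) phi : open U -> U !=set0 -> regular_on U phi -> rational_fun phi.
Proof. by move=> oU U0 rU; exists U; split=> //; exact: (function_field_dense rY ffY). Qed.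

(** The explicit p-th root: its exponents are the contact orders <m, c_j> divided by p. *)
Let psi (z : Y) : k :=
  \prod_(j | finite_section j) ((t1 z - pos j z) / (t2 z - pos j z)) ^ d j.

Let psi_rational (w0 : W) : rational_fun psi.
Proof.
pose z0 : Y := ((w0, Some 0), Some 0).
have r1 : rational_fun t1 by apply: (rational_of open_t1 _ regular_t1); exists z0.
have r2 : rational_fun t2 by apply: (rational_of open_t2 _ regular_t2); exists z0.
have rN phi : rational_fun phi -> rational_fun (fun z : Y => - phi z).
  move=> rphi; rewrite (_ : (fun z => _) = fun z => (fun=> -1) z * phi z).
    apply: rational_mul => //; exists setT; split; [exact: openT| |by move=> x _; exact: regular_cst].
    by move=> O O0 oO; rewrite setIT.
  by apply/funext => z; rewrite mulN1r.
apply: (rational_prod rY) => j /asboolP[w jw].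
have rj : rational_fun (pos j).
  by apply: (rational_of (open_pos j) _ (@regular_pos j)); exists ((w, Some 0), Some 0).
apply: (rational_expz rY ffY); apply: (rational_mul rY).
  by apply: (rational_add rY) => //; exact: rN.
by apply: (rational_inv rY ffY); apply: (rational_add rY) => //; exact: rN.
Qed.

(** Generically both points are finite and unmarked and every marking in [finite_section] is finite,
    so [log_map_character] computes both values on the curve over w. *)
Lemma family_pth_power (w0 : W) : exists2 psi : Y -> k, rational_fun psi &
  generically_equal (fun z => character_fun m (ev2 ev z).1 *
                              character_fun (- m) (ev2 ev z).2) (fun z => psi z ^+ p).
Proof.
exists psi; first exact: psi_rational.
pose z0 : Y := ((w0, Some 0), Some 0).
have g1 : generic Y [set z : Y | finite_part z.1.2].
  by apply: (open_generic rY ffY open_t1); exists z0.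
have g2 : generic Y [set z : Y | finite_part z.2].
  by apply: (open_generic rY ffY open_t2); exists z0.
have gpos : \forall z \near generic Y, forall j, finite_section j -> section_part j z.1.1.
  apply: filter_forall => j; have [[w jw]|nj] := pselect (exists w, section_part j w).
    apply: filterS (open_generic rY ffY (open_pos j) _) => // .
    by exists ((w, Some 0), Some 0).
  by near=> z => /asboolP.
(* The point moves freely on its line while w is fixed; placing it at the marking plus 1 shows that
   the two do not coincide identically. *)
have neq (t : Y -> k) (A : set Y) : open A -> regular_on A t ->
   (forall w s, exists2 z, A z /\ z.1.1 = w & t z = s) ->
   \forall z \near generic Y, forall j, finite_section j -> t z != pos j z.
  move=> oA rA tA; apply: filter_forall => j.
  have [[w jw]|nj] := pselect (exists w, section_part j w); last by near=> z => /asboolP.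
  have : generic Y [set z | t z - pos j z != 0].
    apply: (regular_generic_neq0 rY ffY (openI oA (open_pos j))).
      move=> z [Az Bz].
      have rmin : regular_at z (fun y => (fun=> -1) y * pos j y).
        by apply: (regular_mul rY); [exact: (regular_cst rY)|exact: regular_pos].
      have := regular_add rY (rA z Az) rmin.
      by congr regular_at; apply/funext => y; rewrite mulN1r.
    have [z [Az zw] tz] := tA w (affine_coord (mark j w).2 + 1).
    exists z; first by split; rewrite //= zw.
    by rewrite tz /pos zw addrAC subrr add0r oner_eq0.
  by apply: filterS => z; rewrite /= subr_eq0.
have n1 : \forall z \near generic Y, forall j, finite_section j -> t1 z != pos j z.
  by apply: (neq _ _ open_t1 regular_t1) => w s; exists ((w, Some s), Some 0).
have n2 : \forall z \near generic Y, forall j, finite_section j -> t2 z != pos j z.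
  by apply: (neq _ _ open_t2 regular_t2) => w s; exists ((w, Some 0), Some s).
suff [U [oU dU UE]] : \forall z \near generic Y,
    character_fun m (ev2 ev z).1 * character_fun (- m) (ev2 ev z).2 = psi z ^+ p.
  by exists U; split.
near=> z.
have z1 : finite_part z.1.2 by near: z.
have z2 : finite_part z.2 by near: z.
have zpos : forall j, finite_section j -> section_part j z.1.1 by near: z.
have zn1 : forall j, finite_section j -> t1 z != pos j z by near: z.
have zn2 : forall j, finite_section j -> t2 z != pos j z by near: z.
have [_ _ /(_ z.1.1) flog] := fam.
(* The markings that are finite on this particular curve are those indexing [psi], which is fixed
   for the whole family. *)
have finE j : finite_section j = isSome ((mark j z.1.1).2 : option k).
  apply/idP/idP => [/zpos|jz].
    by rewrite /section_part /=; case: ((mark j z.1.1).2 : option k).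
  apply/asboolP; exists z.1.1; move: jz; rewrite /section_part /=.
  by case: ((mark j z.1.1).2 : option k).
have unmarked s : (forall j, finite_section j -> s != pos j z) ->
    forall j, Some s <> (mark j z.1.1).2 :> option k.
  move=> sn j sj; have jf : finite_section j by rewrite finE -sj.
  by have := sn j jf; rewrite /pos -sj /= eqxx.
have [_ [b b0 bE]] := log_map_character S0 flog mM md.
have e1 : z.1.2 = Some (t1 z) :> option k.
  by move: z1; rewrite /t1 /finite_part /=; case: (z.1.2 : option k).
have e2 : z.2 = Some (t2 z) :> option k.
  by move: z2; rewrite /t2 /finite_part /=; case: (z.2 : option k).
have inv (x : X) : torus x -> character_fun (- m) x = (character_fun m x)^-1.
  move=> Tx; have nz := character_neq0 mM Tx.
  by rewrite -[LHS](mulKf nz) character_inv// mulr1.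
have u1 := unmarked _ zn1; have u2 := unmarked _ zn2.
rewrite /ev2 /= inv; last by rewrite e2; exact: (log_map_torus flog u2).
rewrite e1 e2 bE// [in X in _ / X]bE// -mulf_div divff// mul1r -prodf_div.
rewrite /psi -prodrXl; apply: eq_big => [j|j _]; first by rewrite finE.
by rewrite [RHS]exprnP exprz_exp expfzMl exprz_inv invr_expz.
Unshelve. all: by end_near. Qed.

End Family.

Theorem theorem1p4 (k : closedFieldType) (p : nat) (hp : p \in [pchar k])
    (n : nat) (q : 'I_n.+1 -> nat) (hq : well_formed q)
    (m : 'I_n.+1 -> option nat) (hm : campana_orbifold m)
    (hm1 : forall i, campana_coeff (m i) = 1)
    (j : 'I_n.+1) (hpj : (p %| q j)%N) :
  ~ separably_campana_rationally_connected k (weighted_fan q) m.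
Proof.
move=> [l [c [[alpha [alphaP alphaC]]]]].
move=> [W [ev [mark [varW fam dom [K [L [clsY [clsZ [iota [ffY ffZ compat sep]]]]]]]]]].
(* A finite d gives 1 - 1/d = 1 only through the convention 0^-1 = 0, that is for d = 0, which
   [campana_orbifold] excludes. *)
have mN i : m i = None.
  have := hm1 i; have := hm i; case: (m i) => // d d0 /eqP.
  rewrite /campana_coeff subr_eq -subr_eq0 opprD addrA subrr add0r oppr_eq0.
  rewrite invr_eq0 pnatr_eq0 => /eqP d0'.
  by rewrite d0' eqxx in d0.
have alpha_uniq i h h' : 0 < alpha h i -> 0 < alpha h' i -> h = h'.
  by have := alphaC i; rewrite mN; exact.
have alpha_ge0 h i : 0 <= alpha h i by have [s _ []] := alphaP h.
have cE h : c h = \sum_i alpha h i *: weighted_ray q i by have [s _ []] := alphaP h.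
have pp := pcharf_prime hp.
have S0 : finset.set0 \in cones (weighted_fan q).
  rewrite /= finset.in_set; apply/eqP => /setP/(_ ord0).
  by rewrite finset.in_set0 finset.in_setT.
pose X := toric_variety (weighted_fan q) k.
have rX : regular_ring X by exact: toric_regular_ring.
have rW := variety_regular_ring varW.
have rP1 := @proj_line_regular_ring k.
have rWP := prod_regular_ring rW rP1.
have rY := prod_regular_ring rWP rP1.
have rZ := prod_regular_ring rX rX.
have [w0 _] : exists w : W, True.
  have [x _] := torus_nonempty k S0.
  have [|_ [_ [z _ _]]] := dom setT _ openT; first by exists (x, x).
  by exists z.1.1.
have [_ _ /(_ w0) flog] := fam.
have degE a h : weight_relation q a ->
    pairing (relation_character q a) (c h) = \sum_i alpha h i * (a i)%:~R.
  move=> ra; rewrite cE pairing_sum; apply: eq_bigr => i _.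
  by rewrite pairing_relation_character.
have deg_int a : weight_relation q a -> forall h, \sum_i alpha h i * (a i)%:~R \is a Num.int.
  move=> ra h; rewrite -degE//; have [_ _ _ _ /(_ h)[ch _]] := flog.
  exact: (relation_characterP hq ra).
(* A single curve of the family, the one over [w0], shows that the contact orders have total degree
   zero. *)
have deg_sum0 a : weight_relation q a -> \sum_h \sum_i alpha h i * (a i)%:~R = 0.
  move=> ra; pose d h := Num.floor (\sum_i alpha h i * (a i)%:~R).
  have dE h : pairing (relation_character q a) (c h) = (d h)%:~R.
    by rewrite degE// floorK// deg_int.
  have [d0 _] := log_map_character S0 flog (relation_characterP hq ra) dE.
  under eq_bigr do rewrite -degE// dE.
  by rewrite -rmorph_sum d0.
have [a [ra [i pi] /choice[d dE]]] :=
  exists_pth_power_character hq alpha_ge0 alpha_uniq deg_int deg_sum0 pp hpj.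
pose chi := relation_character q a.
have chiM : characters (weighted_fan q) chi by exact: relation_characterP.
have chid h : pairing chi (c h) = (d h * p%:Z)%:~R by rewrite degE.
pose phi (z : prod_space X X) := character_fun chi z.1 * character_fun (- chi) z.2.
have [psi rpsi psiE] := family_pth_power S0 rW fam ffY chiM chid w0.
have rphi : rational_fun phi.
  have oT := open_torus k S0.
  exists (torus (S := weighted_fan q) `*` torus (S := weighted_fan q)); split.
  - exact: open_prod.
  - apply: (function_field_dense rZ ffZ); first exact: open_prod.
    by have [x Tx] := torus_nonempty k S0; exists (x, x).
  - apply: regular_on_prod => //; apply: character_regular => //.
    exact: charactersN.
have [_ clsE] := cls_congr ffY (rational_exp rY p rpsi) psiE.
have pK := function_field_pchar rY ffY hp.
have [b bE] : exists b, clsZ phi = b ^+ p.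
  apply: (separable_extension_pth_root pK sep (b := clsY psi)).
  by rewrite compat// -(cls_exp rY ffY).
have [theta rtheta thetaE] := ff_surj ffZ b.
have : generically_equal (fun z => theta z ^+ p) phi.
  apply/(ff_eq ffZ) => //; first exact: rational_exp.
  by rewrite (cls_exp rZ ffZ)// thetaE bE.
move=> thetaP; move/negP: pi; apply.
(* The one-parameter subgroup is the i-th ray, on which the character has the value a_i not
   divisible by p. *)
apply: (character_no_pth_root S0 pp chiM _ _ rtheta thetaP (u := weighted_ray q i)).
  exists [ffun h => (h == i)%:Z].
  under eq_bigr do rewrite -tnth_nth tnth_mktuple -scaler_int ffunE.
  rewrite (bigD1 i)//= eqxx scale1r big1 ?addr0// => h /negPf ->.
  by rewrite scale0r.
by rewrite pairing_relation_character.
Qed.
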